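(* Let $p$ be a prime number, let $X=\Omega_p$ be the (additive, locally compact) group of $p$-adic numbers, and let $\alpha\in\mathrm{Aut}(X)$ be a topological automorphism, i.e. multiplication by a nonzero element of $\Omega_p$, again denoted $\alpha$; write $\alpha=p^k c$ with $k\in\mathbb{Z}$ and $c\in\Delta_p^0$. Then the following statements hold. 1. Assume that either $k=0$ or $|k|=1$. Let $\xi_1$ and $\xi_2$ be independent random variables with values in $X$ and distributions $\mu_1$ and $\mu_2$. Assume that the linear forms $L_1=\xi_1+\xi_2$ and $L_2=\xi_1+\alpha\xi_2$ are independent. Then: 1(i) If $k=0$, then $\mu_1,\mu_2\in I(X)$; moreover, if the zeroth $p$-adic digit of $c$ equals $1$ (i.e. $c=1+c_1p+c_2p^2+\cdots$ with $c_n\in\{0,1,\dots,p-1\}$), then $\mu_1$ and $\mu_2$ are degenerate distributions. 1(ii) If $|k|=1$, then either $\mu_1\in I(X)$ or $\mu_2\in I(X)$. 2. If $|k|\ge 2$, then there exist independent random variables $\xi_1$ and $\xi_2$ with values in $X$ and distributions $\mu_1$ and $\mu_2$ such that the linear forms $L_1=\xi_1+\xi_2$ and $L_2=\xi_1+\alpha\xi_2$ are independent, whereas $\mu_1\notin I(X)$ and $\mu_2\notin I(X)$.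
   Context: $\Omega_p$ denotes the field of $p$-adic numbers with its usual topology, regarded as an additive locally compact Abelian group; each element is written $x=\sum_{n\ge n_0}x_np^n$ with digits $x_n\in\{0,1,\dots,p-1\}$. $\Delta_p$ is the subgroup (ring) of $p$-adic integers, and $\Delta_p^0$ is the set of elements invertible in $\Delta_p$, i.e. $x\in\Omega_p$ with $x_n=0$ for $n<0$ and $x_0\neq 0$. Every topological automorphism of the group $\Omega_p$ is multiplication by a nonzero element of $\Omega_p$, and every nonzero element is uniquely of the form $p^kc$ with $k\in\mathbb{Z}$, $c\in\Delta_p^0$. Distributions are Borel probability measures on $X$. $I(X)$ is the set of idempotent distributions on $X$, meaning all shifts (translates) $m_K*E_x$, where $K$ is a compact subgroup of $X$, $m_K$ is the normalized Haar measure on $K$ (as a probability measure on $X$), $x\in X$, and $E_x$ is the point mass at $x$. A degenerate distribution is one of the form $E_x$, $x\in X$ (so degenerate distributions belong to $I(X)$). In 1(ii), ''either ... or'' is inclusive. *)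

(* Defs.v *)
From HB Require Import structures.
From mathcomp Require Import all_boot all_order all_algebra.
From mathcomp Require Import all_classical all_reals all_analysis.

Set Implicit Arguments.
Unset Strict Implicit.
Unset Printing Implicit Defensive.

Import Order.TTheory GRing.Theory Num.Theory.
Local Open Scope classical_set_scope.
Local Open Scope ring_scope.

(* The p-adic integers as the inverse limit of the rings Z/p^n: [x n] is the
   representative in [0, p^n) of x modulo p^n; the coherence condition alone
   forces [x n < p ^ n]. *)
Record padic_int (p : nat) (pr_p : prime p) : Type := PadicInt {
  residue :> nat -> nat;
  residueP : forall n, (residue n.+1 %% p ^ n)%N = residue n }.

Section PadicIntRing.
Variables (p : nat) (pr_p : prime p).
Local Notation Zp := (padic_int pr_p).
Implicit Types x y z : Zp.

HB.instance Definition _ := gen_eqMixin Zp.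
HB.instance Definition _ := gen_choiceMixin Zp.

Lemma padic_int_eq x y : (forall n, x n = y n) -> x = y.
Proof.
case: x y => [x hx] [y hy] /= /funext exy; rewrite -{}exy in hy *.
by rewrite (Prop_irrelevance hx hy).
Qed.

Lemma residue_mod x n : (x n %% p ^ n)%N = x n.
Proof. by rewrite -residueP modn_mod. Qed.

Lemma residue_mod_le x m n : (m <= n)%N -> (x n %% p ^ m)%N = x m.
Proof.
elim: n => [|n IHn]; first by rewrite leqn0 => /eqP ->; rewrite residue_mod.
rewrite leq_eqVlt => /predU1P[->|]; first exact: residue_mod.
rewrite ltnS => lemn.
by rewrite -(IHn lemn) -(residueP x n) modn_dvdm// dvdn_exp2l.
Qed.

(* [f n] only matters modulo p^n. *)
Lemma padic_of_subproof (f : nat -> nat) :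
  (forall n, (f n.+1 = f n %[mod p ^ n])%N) ->
  forall n, ((f n.+1 %% p ^ n.+1) %% p ^ n)%N = (f n %% p ^ n)%N.
Proof. by move=> hf n; rewrite modn_dvdm ?hf// dvdn_exp2l. Qed.

Definition padic_of f hf : Zp := PadicInt pr_p (@padic_of_subproof f hf).

Lemma zero_subproof n : (0 = 0 %[mod p ^ n])%N. Proof. by []. Qed.
Lemma one_subproof n : (1 = 1 %[mod p ^ n])%N. Proof. by []. Qed.
Lemma add_subproof x y n : (x n.+1 + y n.+1 = x n + y n %[mod p ^ n])%N.
Proof. by rewrite -modnDm !residueP. Qed.
Lemma mul_subproof x y n : (x n.+1 * y n.+1 = x n * y n %[mod p ^ n])%N.
Proof. by rewrite -modnMm !residueP. Qed.
Lemma opp_subproof x n :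
  (p ^ n.+1 - x n.+1 = p ^ n - x n %[mod p ^ n])%N.
Proof.
have le m : (x m <= p ^ m)%N.
  by rewrite -residue_mod ltnW// ltn_mod expn_gt0 prime_gt0.
apply/eqP; rewrite -(eqn_modDr (x n)) subnK//.
rewrite -(residueP x n) modnDmr subnK//.
by rewrite modnn expnS modnMl.
Qed.

Definition padic_zero := padic_of zero_subproof.
Definition padic_one := padic_of one_subproof.
Definition padic_add x y := padic_of (add_subproof x y).
Definition padic_mul x y := padic_of (mul_subproof x y).
Definition padic_opp x := padic_of (opp_subproof x).

Lemma padic_addA : associative padic_add.
Proof.
by move=> x y z; apply: padic_int_eq => n /=; rewrite modnDmr modnDml addnA.
Qed.
Lemma padic_addC : commutative padic_add.
Proof. by move=> x y; apply: padic_int_eq => n /=; rewrite addnC. Qed.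
Lemma padic_add0 : left_id padic_zero padic_add.
Proof.
by move=> x; apply: padic_int_eq => n /=; rewrite mod0n add0n residue_mod.
Qed.
Lemma padic_addN : left_inverse padic_zero padic_opp padic_add.
Proof.
move=> x; apply: padic_int_eq => n /=; rewrite modnDml subnK ?modnn ?mod0n//.
by rewrite -residue_mod ltnW// ltn_mod expn_gt0 prime_gt0.
Qed.
HB.instance Definition _ :=
  GRing.isZmodule.Build Zp padic_addA padic_addC padic_add0 padic_addN.

Lemma padic_mulA : associative padic_mul.
Proof.
by move=> x y z; apply: padic_int_eq => n /=; rewrite modnMmr modnMml mulnA.
Qed.
Lemma padic_mulC : commutative padic_mul.
Proof. by move=> x y; apply: padic_int_eq => n /=; rewrite mulnC. Qed.
Lemma padic_mul1 : left_id padic_one padic_mul.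
Proof.
by move=> x; apply: padic_int_eq => n /=; rewrite modnMml mul1n residue_mod.
Qed.
Lemma padic_mulD : left_distributive padic_mul +%R.
Proof.
move=> x y z; apply: padic_int_eq => n /=.
by rewrite modnMml modnDm mulnDl.
Qed.
Lemma padic_one_neq0 : padic_one != 0.
Proof.
apply/eqP => /(congr1 (fun x : Zp => x 1%N)) /=.
by rewrite expn1 modn_small ?prime_gt1// mod0n.
Qed.
HB.instance Definition _ := GRing.Zmodule_isComNzRing.Build Zp
  padic_mulA padic_mulC padic_mul1 padic_mulD padic_one_neq0.

Definition padic_unit : pred Zp := fun x => `[< exists y, y * x = 1 >].
(* a junk value when x has no inverse *)
Definition padic_inv x : Zp := xget x [set y | y * x = 1].

Lemma padic_mulVx : {in padic_unit, left_inverse 1 padic_inv *%R}.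
Proof. by move=> x /asboolP ex; exact: (xgetPex x ex). Qed.
Lemma padic_unitPl x y : y * x = 1 -> padic_unit x.
Proof. by move=> yx1; apply/asboolP; exists y. Qed.
Lemma padic_invx_out : {in [predC padic_unit], padic_inv =1 id}.
Proof.
by move=> x /asboolPn nx; apply: xgetPN => y yx1; apply: nx; exists y.
Qed.
HB.instance Definition _ := GRing.ComNzRing_hasMulInverse.Build Zp
  padic_mulVx padic_unitPl padic_invx_out.

Lemma padic_mulf_eq0 x y : x * y = 0 -> (x == 0) || (y == 0).
Proof.
have neq0P z : z != 0 -> exists n, z n != 0%N.
  move=> z0; apply: contrapT => /forallNP nz; case/eqP: z0.
  by apply: padic_int_eq => n /=; rewrite mod0n; apply/eqP/negPn/negP.
move=> xy0; apply: contraPT xy0; rewrite negb_or => /andP[].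
move=> /neq0P[i xi] /neq0P[j yj].
have ndvd z m n : (m <= n)%N -> z m != 0%N -> ~~ (p ^ m %| z n)%N.
  by move=> lemn; rewrite /dvdn residue_mod_le.
have {}xi := ndvd _ _ _ (leq_addr j i) xi.
have {}yj := ndvd _ _ _ (leq_addl i j) yj.
have gt0 m n : ~~ (p ^ m %| n)%N -> (0 < n)%N by case: n; rewrite ?dvdn0.
move=> /(congr1 (fun z : Zp => z (i + j)%N)) /= /eqP.
rewrite mod0n -/(dvdn _ _) pfactor_dvdn// ?muln_gt0 ?(gt0 _ _ xi) ?(gt0 _ _ yj)//.
rewrite lognM ?(gt0 _ _ xi) ?(gt0 _ _ yj)//.
move: (xi) (yj); rewrite !pfactor_dvdn ?(gt0 _ _ xi) ?(gt0 _ _ yj)//.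
by rewrite -!ltnNge => lti ltj; rewrite leqNgt -addSn leq_add// ltnW.
Qed.
HB.instance Definition _ :=
  GRing.ComUnitRing_isIntegral.Build Zp padic_mulf_eq0.

End PadicIntRing.

(* The n-th digit c_n, in {0, ..., p - 1}, of c = c_0 + c_1 p + c_2 p^2 + ... *)
Definition padic_digit (p : nat) (pr_p : prime p) (c : padic_int pr_p)
  (n : nat) : nat := (c n.+1 %/ p ^ n)%N.

Definition padic (p : nat) (pr_p : prime p) : Type := {fraction padic_int pr_p}.

HB.instance Definition _ (p : nat) (pr_p : prime p) :=
  GRing.Field.on (padic pr_p).

Definition padic_of_int (p : nat) (pr_p : prime p) (z : padic_int pr_p) :
  padic pr_p := @tofrac (padic_int pr_p) z.

Section PadicTopology.
Variables (p : nat) (pr_p : prime p).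
Local Notation Qp := (padic pr_p).

(* the subgroup p^n Z_p *)
Definition padic_ball (n : nat) : set Qp :=
  [set x | exists z, x = p%:R ^+ n * padic_of_int z].

Lemma padic_ball0 n : padic_ball n 0.
Proof. by exists 0; rewrite /padic_of_int rmorph0 mulr0. Qed.

Lemma padic_ballN n x : padic_ball n x -> padic_ball n (- x).
Proof. by case=> z ->; exists (- z); rewrite /padic_of_int rmorphN mulrN. Qed.

Lemma padic_ballD n x y :
  padic_ball n x -> padic_ball n y -> padic_ball n (x + y).
Proof.
by case=> z -> [t ->]; exists (z + t); rewrite /padic_of_int rmorphD mulrDr.
Qed.

Lemma padic_ball_le m n : (m <= n)%N -> padic_ball n `<=` padic_ball m.
Proof.
move=> lemn x [z ->]; exists (p%:R ^+ (n - m) * z).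
by rewrite /padic_of_int rmorphM rmorphXn rmorph_nat mulrA -exprD subnKC.
Qed.

(* the uniformity of the group (Q_p, +) whose basic neighbourhoods of 0 are
   the p^n Z_p, that is, of the p-adic absolute value *)
Definition padic_entourage : set_system (Qp * Qp) :=
  [set E | exists n, [set xy | padic_ball n (xy.2 - xy.1)] `<=` E].

Lemma padic_entourage_filter : Filter padic_entourage.
Proof.
split; first by exists 0%N.
- move=> A B [m hA] [n hB]; exists (maxn m n) => xy hxy; split.
  + by apply: hA; apply: padic_ball_le hxy; exact: leq_maxl.
  + by apply: hB; apply: padic_ball_le hxy; exact: leq_maxr.
- by move=> A B sAB [n hA]; exists n; exact: subset_trans sAB.
Qed.

Lemma padic_entourage_diagonal A :
  padic_entourage A -> (diagonal `<=` A)%relation.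
Proof.
move=> [n hA] [x y] /= exy; apply: hA => /=.
by rewrite -[y]exy subrr; exact: padic_ball0.
Qed.

Lemma padic_entourage_inv A :
  padic_entourage A -> padic_entourage (A^-1)%relation.
Proof.
move=> [n hA]; exists n => -[x y] /= hxy; apply: hA => /=.
by rewrite -opprB; exact: padic_ballN.
Qed.

Lemma padic_entourage_split A : padic_entourage A ->
  exists2 B, padic_entourage B & (B \; B `<=` A)%relation.
Proof.
move=> [n hA]; exists [set xy | padic_ball n (xy.2 - xy.1)]; first by exists n.
move=> [x y] [z /= hxz hzy]; apply: hA => /=.
by rewrite -(subrKA z) addrC; apply: padic_ballD; rewrite // addrC.
Qed.

HB.instance Definition _ := isUniform.Build Qp padic_entourage_filter
  padic_entourage_diagonal padic_entourage_inv padic_entourage_split.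
HB.instance Definition _ := isPointed.Build Qp 0.

(* the Borel sigma-algebra *)
HB.instance Definition _ :=
  Measurable.copy Qp (g_sigma_algebraType (@open Qp)).

End PadicTopology.

Section Distributions.
Variables (R : realType) (p : nat) (pr_p : prime p).
Local Notation Qp := (padic pr_p).
Local Open Scope ereal_scope.

Definition compact_subgroup (K : set Qp) : Prop :=
  [/\ compact K, K 0%R & forall x y, K x -> K y -> K (x - y)%R].

(* [m], a measure on the whole of Q_p, is the normalized Haar measure of [K] *)
Definition haar_probability (K : set Qp) (m : probability Qp R) : Prop :=
  m K = 1 /\
  forall x A, K x -> measurable A -> m [set y | A (x + y)%R] = m A.

Definition convolution (mu nu : set Qp -> \bar R) (A : set Qp) : \bar R :=
  \int[mu]_x nu [set y | A (x + y)%R].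

Definition idempotent_distribution (mu : probability Qp R) : Prop :=
  exists (K : set Qp) (m : probability Qp R) (x : Qp),
    [/\ compact_subgroup K, haar_probability K m &
        forall A, measurable A -> mu A = convolution m (\d_x) A].

Definition degenerate_distribution (mu : probability Qp R) : Prop :=
  exists x : Qp, forall A, measurable A -> mu A = \d_x A.

End Distributions.

Definition independent_rv (R : realType) (d d1 d2 : measure_display)
    (T : measurableType d) (T1 : measurableType d1) (T2 : measurableType d2)
    (P : probability T R) (X : T -> T1) (Y : T -> T2) : Prop :=
  [/\ measurable_fun setT X, measurable_fun setT Y &
    forall A B, measurable A -> measurable B ->
      P (X @^-1` A `&` Y @^-1` B) = (P (X @^-1` A) * P (Y @^-1` B))%E].

(* Main.v *)
Require Import Defs.
From HB Require Import structures.
From mathcomp Require Import all_boot all_order all_algebra.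
From mathcomp Require Import all_classical all_reals all_analysis.
From mathcomp Require Import cyclic fraction generic_quotient measurable_realfun.
From mathcomp Require Import ring lra zify.

(* Independence of L1 and L2 is read off on cosets of p^n Z_p, without Fourier
   analysis. Replacing alpha by its inverse (and exchanging the variables) we
   may take alpha in Z_p.
   - A tail estimate, based on the ultrametric inequality, shows that xi1 and
     xi2 lie almost surely in a ball.
   - If alpha = 1 mod p, and both variables lie in cosets of p^k Z_p, then L1
     and L2 differ by a constant modulo p^(k+1); being independent they are
     constant modulo p^(k+1), hence so are xi1 and xi2. Iterating, both are
     degenerate.
   - If 1 - alpha is a unit, (x, y) -> (x + y, x + alpha y) is a bijection of
     (Z/p^N)^2, so that the masses a, b of the cosets satisfy
     a(x) b(y) = l1(x + y) l2(x + alpha y). Once the maxima are translated to 0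
     this improves to a(x) b(y) = b(x + y) a(x + alpha y). Working at the
     smallest ball containing the variables, one of the two supports generates
     Z/p^N, and comparing values at a maximum forces a or b to be constant.
   - For alpha = p^k c with k >= 2, take xi2 in Z_p with a law invariant under
     p Z_p but not uniform on Z_p / p Z_p, and let xi1 be distributed as p xi2:
     then adding xi1 does not change the law of xi2, nor adding alpha xi2 that
     of xi1. *)

Set Implicit Arguments.
Unset Strict Implicit.
Unset Printing Implicit Defensive.

Import Order.TTheory GRing.Theory Num.Theory.
Local Open Scope classical_set_scope.
Local Open Scope ring_scope.

(** * Factored functions on finite rings *)

Section FiniteRing.
Variables (R : realFieldType) (G : finComUnitRingType).
Implicit Types (a b f : G -> R).

(** The nonnegative differences [f (s y) - f y] sum to zero, since [s] permutes the finite ring. *)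
Lemma le_perm_eq f (s : G -> G) : injective s ->
  (forall x, f x <= f (s x)) -> forall x, f (s x) = f x.
Proof.
move=> s_inj le_f x; apply/eqP; rewrite -subr_eq0; apply/eqP.
have: \sum_y (f (s y) - f y) = 0.
  by rewrite sumrB [X in _ - X](reindex_inj s_inj)/= subrr.
by move/psumr_eq0P; apply=> // y _; rewrite subr_ge0.
Qed.

Variables (al : G) (unit_al1 : 1 - al \is a GRing.unit).

(* Putting y = 0 gives a x <= a (g x), hence a x = a (g x) because g permutes the
   finite ring; so the other factors equal 1 wherever a x is nonzero. *)
Lemma independence_iterated a b :
  (forall x, 0 <= a x <= 1) -> (forall x, 0 <= b x <= 1) -> a 0 = 1 -> b 0 = 1 ->
  (forall x y, let g := (1 - al)^-1 in
     let u := g * (x + y) in let v := g * (x + al * y) in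
     a x * b y = a (- al * u) * b u * (a v * b (- v))) ->
  forall x y, a x * b y = b (x + y) * a (x + al * y).
Proof.
move=> a01 b01 a0 b0 E; set g := (1 - al)^-1 in E.
have ge0a x : 0 <= a x by case/andP: (a01 x).
have ge0b x : 0 <= b x by case/andP: (b01 x).
have le1a x : a x <= 1 by case/andP: (a01 x).
have le1b x : b x <= 1 by case/andP: (b01 x).
have gu : g \is a GRing.unit by rewrite unitrV.
have g_inj : injective ( *%R g) := mulrI gu.
have Ea x : a x = a (- al * (g * x)) * b (g * x) * (a (g * x) * b (- (g * x))).
  by have := E x 0; rewrite /= mulr0 !addr0 b0 mulr1.
have Eb y : b y = a (- al * (g * y)) * b (g * y)
    * (a (g * (al * y)) * b (- (g * (al * y)))).
  by have := E 0 y; rewrite /= !add0r a0 mul1r.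
have ag x : a (g * x) = a x.
  apply: (@le_perm_eq a ( *%R g)) => // {}x; rewrite {1}Ea.
  have := ge0a (- al * (g * x)); have := le1a (- al * (g * x)).
  have := ge0b (g * x); have := le1b (g * x).
  have := ge0b (- (g * x)); have := le1b (- (g * x)); have := ge0a (g * x).
  move=> h1 h2 h3 h4 h5 h6 h7.
  rewrite mulrCA -[leRHS]mulr1 ler_wpM2l// mulr_ile1 ?mulr_ge0// mulr_ile1//.
have bg x : b (g * x) = b x.
  apply: (@le_perm_eq b ( *%R g)) => // {}x; rewrite {1}Eb.
  rewrite (mulrC (a _)) -mulrA -[leRHS]mulr1 ler_wpM2l// mulr_ile1 ?mulr_ge0//.
  by rewrite mulr_ile1.
(* Meant for [Ea] and [Eb] at a nonzero value: invariance under [g] makes one factor equal to the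
   left side, which can then be cancelled. *)
have one3 (s t u w : R) : 0 <= t <= 1 -> 0 <= u <= 1 -> 0 <= w <= 1 ->
    s * (t * (u * w)) = s -> s != 0 -> [/\ t = 1, u = 1 & w = 1].
  move=> /andP[t0 t1] /andP[u0 u1] /andP[w0 w1] H s0.
  have {}H : t * (u * w) = 1 by apply: (mulfI s0); rewrite H mulr1.
  have uw1 : u * w <= 1 by rewrite mulr_ile1.
  have uw0 : 0 <= u * w by rewrite mulr_ge0.
  have t1' : t = 1.
    apply/eqP; rewrite eq_le t1 -H ler_piMr//.
  rewrite t1' mul1r in H.
  have u1' : u = 1 by apply/eqP; rewrite eq_le u1 -H ler_piMr.
  by rewrite u1' mul1r in H.
have Fa x : a x != 0 -> b (- x) = 1.
  rewrite -(mulVKr gu x) => ax0.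
  have [] := @one3 (a (g^-1 * x)) (a (- al * (g * (g^-1 * x))))
     (b (g * (g^-1 * x))) (b (- (g * (g^-1 * x)))) => //.
    by rewrite [RHS]Ea -(ag (g^-1 * x)); ring.
  by rewrite -(ag (g^-1 * x)).
have Fb y : b y != 0 -> a (- al * y) = 1.
  rewrite -(mulVKr gu y) => by0.
  have [] := @one3 (b (g^-1 * y)) (a (- al * (g * (g^-1 * y))))
     (a (g * (al * (g^-1 * y)))) (b (- (g * (al * (g^-1 * y))))) => //.
    by rewrite [RHS]Eb -(bg (g^-1 * y)); ring.
  by rewrite -(bg (g^-1 * y)).
(* With u and v as in [E]: where [b u] is nonzero [Fb] gives [a (- al * u) = 1], and where [a v] is
   nonzero [Fa] gives [b (- v) = 1], so each pair of factors reduces to one. *)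
move=> x y; rewrite E /= -/g; congr (_ * _).
  rewrite bg; have [->|nz] := eqVneq (b (x + y)) 0; first by rewrite mulr0.
  by rewrite Fb ?mul1r// bg.
rewrite ag; have [->|nz] := eqVneq (a (x + al * y)) 0; first by rewrite mul0r.
by rewrite Fa ?mulr1// ag.
Qed.

End FiniteRing.

Section FactoredMasses.
Variables (R : realFieldType) (G : finComUnitRingType) (al : G).
Variables (a b l1 l2 : G -> R).
Hypotheses (unit_al1 : 1 - al \is a GRing.unit).
Hypotheses (a_ge0 : forall x, 0 <= a x) (b_ge0 : forall x, 0 <= b x).
Hypotheses (a_neq0 : exists x, a x != 0) (b_neq0 : exists x, b x != 0).
Hypothesis abE : forall x y, a x * b y = l1 (x + y) * l2 (x + al * y).

(* Shift the maxima of the two masses to the origin and eliminate [l1], [l2]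
   by solving u = x + y, v = x + al * y. *)
Lemma factored_masses : exists x0 y0, [/\ a x0 != 0, b y0 != 0,
  (forall x, a x <= a x0) /\ (forall y, b y <= b y0) &
  forall x y, a (x0 + x) * b (y0 + y) =
              b (y0 + (x + y)) * a (x0 + (x + al * y))].
Proof.
have max f : (forall x, 0 <= f x) -> (exists x, f x != 0) ->
    exists2 x0 : G, f x0 != 0 & forall x, f x <= f x0 :> R.
  move=> f0 [x fx]; case: (@arg_maxP _ _ _ x xpredT f isT) => y _ fy.
  exists y; last by move=> z; exact: fy.
  by rewrite gt_eqF// (lt_le_trans _ (fy x isT))// lt_neqAle eq_sym fx f0.
have [x0 ax0 max_a] := max a a_ge0 a_neq0.
have [y0 by0 max_b] := max b b_ge0 b_neq0.
exists x0, y0; split=> // x y.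
pose a' x := a (x0 + x) / a x0; pose b' y := b (y0 + y) / b y0.
have ax0_gt0 : 0 < a x0 by rewrite lt_neqAle eq_sym ax0 a_ge0.
have by0_gt0 : 0 < b y0 by rewrite lt_neqAle eq_sym by0 b_ge0.
have norm z t : a (x0 + z) * b (y0 + t) = a' z * b' t * (a x0 * b y0).
  by rewrite /a' /b'; field; rewrite ax0 by0.
rewrite norm [RHS]mulrC norm; congr (_ * _); rewrite [RHS]mulrC.
apply: (independence_iterated unit_al1) => [z|z|||{}x {}y /=].
- by rewrite divr_ge0//= ler_pdivrMr// mul1r.
- by rewrite divr_ge0//= ler_pdivrMr// mul1r.
- by rewrite /a' addr0 divff.
- by rewrite /b' addr0 divff.
set g := (1 - al)^-1; set u := g * _; set v := g * _.
have gal : g * (1 - al) = 1 by rewrite mulVr.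
have uE : - al * u + u = x + y.
  by transitivity (g * (1 - al) * (x + y)); [rewrite /u; ring|rewrite gal mul1r].
have vE : v + al * - v = x + al * y.
  by transitivity (g * (1 - al) * (x + al * y));
    [rewrite /v; ring|rewrite gal mul1r].
have c0 : a x0 * b y0 != 0 by rewrite mulf_neq0.
apply: (mulIf (mulf_neq0 c0 c0)); rewrite [LHS]mulrA -norm.
(* The points (x0 - al u, y0 + u) and (x0 + v, y0 - v) share between them, crosswise, the values of
   the two forms at (x0 + x, y0 + y) and (x0, y0): the four factors [l1], [l2] are the same. *)
transitivity ((a (x0 - al * u) * b (y0 + u)) * (a (x0 + v) * b (y0 - v))).
  rewrite !abE.
  have -> : x0 - al * u + (y0 + u) = x0 + x + (y0 + y).
    by transitivity (x0 + y0 + (- al * u + u)); [ring|rewrite uE; ring].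
  have -> : x0 - al * u + al * (y0 + u) = x0 + al * y0 by ring.
  have -> : x0 + v + (y0 - v) = x0 + y0 by ring.
  have -> : x0 + v + al * (y0 - v) = x0 + x + al * (y0 + y).
    by transitivity (x0 + al * y0 + (v + al * - v)); [ring|rewrite vE; ring].
  ring.
by rewrite !norm !mulNr; ring.
Qed.

End FactoredMasses.

Lemma expn_prime_gt1 p n : prime p -> (0 < n)%N -> (1 < p ^ n)%N.
Proof.
move=> pr_p n_gt0; rewrite (leq_trans (prime_gt1 pr_p))//.
by rewrite -{1}(expn1 p) leq_pexp2l// prime_gt0.
Qed.

(** * Constancy of factored masses on Z/p^N *)

Section PrimePower.
Variables (R : realFieldType) (p N : nat).
Hypotheses (pr_p : prime p) (N_gt0 : (0 < N)%N).
Local Notation G := 'Z_(p ^ N).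

Let q_gt1 : (1 < p ^ N)%N := expn_prime_gt1 pr_p N_gt0.

Lemma Zp_unit_multiple (u x : G) : u \is a GRing.unit -> exists n, x = u *+ n.
Proof.
by move=> uu; exists (x / u : G); rewrite -mulr_natl natr_Zp divrK.
Qed.

Lemma Zp_unit_primeD (u x : G) :
  u \is a GRing.unit -> u + p%:R * x \is a GRing.unit.
Proof.
rewrite -[u]natr_Zp -[x]natr_Zp -natrM -natrD !unitZpE//.
by rewrite !coprime_pexpl// /coprime addnC mulnC gcdnMDl.
Qed.

Lemma Zp_nonunit (x : G) : x \isn't a GRing.unit -> exists t, x = p%:R * t.
Proof.
rewrite -[x]natr_Zp unitZpE// coprime_pexpl// prime_coprime// negbK.
by move=> /dvdnP[m ->]; exists m%:R; rewrite mulnC natrM.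
Qed.

(** A unit generates the additive group, and by [le_perm_eq] the shift by it leaves [f]
    unchanged. *)
Lemma le_shift_const (f : G -> R) (u : G) : u \is a GRing.unit ->
  (forall x, f x <= f (x + u)) -> forall x y, f x = f y.
Proof.
move=> uu le_f; have fE := le_perm_eq (addIr u) le_f.
suff f0 x : f x = f 0 by move=> x y; rewrite !f0.
have [n ->] := Zp_unit_multiple x uu.
by elim: n => [|n IHn]; rewrite ?mulr0n// mulrSr fE.
Qed.

Variables (a b l1 l2 : G -> R) (al : G).
Hypotheses (unit_al1 : 1 - al \is a GRing.unit).
Hypotheses (a_ge0 : forall x, 0 <= a x) (b_ge0 : forall x, 0 <= b x).
Hypotheses (a_neq0 : exists x, a x != 0) (b_neq0 : exists x, b x != 0).
Hypothesis abE : forall x y, a x * b y = l1 (x + y) * l2 (x + al * y).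

(** The support of [f] lies in no single coset of p G, the nonunits of G being the multiples of
    p. *)
Definition spread (f : G -> R) :=
  forall x, exists2 y, f y != 0 & y - x \is a GRing.unit.

(** Choose x in the support of [a] with x - x0 a unit. The identity [E] propagates nonvanishing of
    [b] along the multiples of x - x0, that is, everywhere; then [aP] makes [a] constant because
    [al] is a unit, and [bP] makes [b] constant. *)
Lemma masses_const_l :
  al \is a GRing.unit -> spread a -> forall x y, a x = a y /\ b x = b y.
Proof.
move=> u_al spa.
have [x0 [y0 [ax0 by0 _ E]]] :=
  factored_masses unit_al1 a_ge0 b_ge0 a_neq0 b_neq0 abE.
have bP x : a (x0 + x) != 0 -> b (y0 + x) = b y0.
  by move=> ax; have := E x 0; rewrite mulr0 !addr0 mulrC => /(mulIf ax).
have aP y : b (y0 + y) != 0 -> a (x0 + al * y) = a x0.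
  by move=> ay; have := E 0 y; rewrite !add0r addr0 mulrC => /(mulfI ay).
have [x ax ux] := spa x0.
have bn n : b (y0 + (x - x0) *+ n) != 0.
  elim: n => [|n IHn]; first by rewrite mulr0n addr0.
  have : a (x0 + (x - x0)) * b (y0 + (x - x0) *+ n) != 0.
    by rewrite mulf_neq0// addrC subrK.
  by rewrite E mulf_eq0 negb_or mulrS => /andP[].
have aE y : a y = a x0.
  have [n yE] := Zp_unit_multiple (al^-1 * (y - x0)) ux.
  by have := aP _ (bn n); rewrite -yE mulVKr// addrC subrK.
have bE y : b y = b y0 by rewrite -[y](subrK y0) addrC bP// aE.
by move=> s t; rewrite !aE !bE.
Qed.

(** Reduces to the previous case: y -> x0 + al (y - y0) sends the support of [b] into that of [a],
    and the unit [al] preserves differences that are units. *)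
Lemma masses_const_r :
  al \is a GRing.unit -> spread b -> forall x y, a x = a y /\ b x = b y.
Proof.
move=> u_al spb; apply: masses_const_l => // z.
have [x0 [y0 [ax0 by0 _ E]]] :=
  factored_masses unit_al1 a_ge0 b_ge0 a_neq0 b_neq0 abE.
have [y bz uy] := spb (y0 + al^-1 * (z - x0)).
exists (x0 + al * (y - y0)).
  have := E 0 (y - y0); rewrite !add0r addr0 [y0 + _]addrC subrK mulrC.
  by move/(mulfI bz) <-.
suff -> : x0 + al * (y - y0) - z = al * (y - (y0 + al^-1 * (z - x0))).
  by rewrite unitrM u_al.
by rewrite [RHS]mulrBr [X in _ = _ - X]mulrDr mulVKr//; ring.
Qed.

Variable c : G.
Hypothesis alE : al = p%:R * c.

(** Let x be in the support of [a] with x - x0 a unit, and let x0 + w maximize [a] on x + al G. Then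
    w is still a unit, as p divides [al], and [E] at w together with maximality gives b (y0 + z) <=
    b (y0 + z + w) for all z. *)
Lemma masses_const_of_spread : spread a -> forall x y, b x = b y.
Proof.
move=> spa.
have [x0 [y0 [ax0 by0 _ E]]] :=
  factored_masses unit_al1 a_ge0 b_ge0 a_neq0 b_neq0 abE.
have [x ax ux] := spa x0.
have bn n : b (y0 + (x - x0) *+ n) != 0.
  elim: n => [|n IHn]; first by rewrite mulr0n addr0.
  have : a (x0 + (x - x0)) * b (y0 + (x - x0) *+ n) != 0.
    by rewrite mulf_neq0// addrC subrK.
  by rewrite E mulf_eq0 negb_or mulrS => /andP[].
case: (@arg_maxP _ _ _ 0 xpredT (fun y : G => a (x + al * y)) isT) => y _ max_y.
set w := x - x0 + al * y.
have aw : a (x0 + w) != 0.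
  have -> : x0 + w = x + al * y by rewrite /w; ring.
  rewrite gt_eqF// (lt_le_trans _ (max_y 0 isT))// mulr0 addr0.
  by rewrite lt_neqAle eq_sym ax a_ge0.
have uw : w \is a GRing.unit by rewrite /w alE -mulrA Zp_unit_primeD.
suff bE : forall s t, b (y0 + s) = b (y0 + t).
  by move=> s t; rewrite -[s](subrK y0) -[t](subrK y0) ![_ + y0]addrC.
apply: (le_shift_const uw) => z.
have a_gt0 : 0 < a (x0 + w) by rewrite lt_neqAle eq_sym aw a_ge0.
rewrite -(ler_pM2l a_gt0) E mulrC [z + w]addrC ler_wpM2r//.
have -> : x0 + (w + al * z) = x + al * (y + z) by rewrite /w; ring.
have -> : x0 + w = x + al * y by rewrite /w; ring.
exact: max_y.
Qed.

(** Here y0 + w maximizes [b] on y + p G, with w a unit. Comparing in [E] gives a (x0 + p s) <= a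
    (x0 + p (s + c w)), and c w is a unit; since [al] moves points only by multiples of p, the
    conclusion is confined to one coset of p G. *)
Lemma masses_const_prime_coset : c \is a GRing.unit -> spread b ->
  exists2 x0, a x0 != 0 & forall t, a (x0 + p%:R * t) = a x0.
Proof.
move=> uc spb.
have [x0 [y0 [ax0 by0 _ E]]] :=
  factored_masses unit_al1 a_ge0 b_ge0 a_neq0 b_neq0 abE.
exists x0 => //.
have [y by_ uy] := spb y0.
case: (@arg_maxP _ _ _ 0 xpredT (fun z : G => b (y + p%:R * z)) isT) => z _ max_z.
set w := y - y0 + p%:R * z.
have bw : b (y0 + w) != 0.
  have -> : y0 + w = y + p%:R * z by rewrite /w; ring.
  rewrite gt_eqF// (lt_le_trans _ (max_z 0 isT))// mulr0 addr0.
  by rewrite lt_neqAle eq_sym by_ b_ge0.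
have uw : w \is a GRing.unit by rewrite Zp_unit_primeD.
have b_gt0 : 0 < b (y0 + w) by rewrite lt_neqAle eq_sym bw b_ge0.
have aE : forall s t, a (x0 + p%:R * s) = a (x0 + p%:R * t).
  apply: (@le_shift_const (fun s => a (x0 + p%:R * s)) (c * w)).
    by rewrite unitrM uc.
  move=> s; rewrite -(ler_pM2r b_gt0) E mulrC.
  have -> : x0 + (p%:R * s + al * w) = x0 + p%:R * (s + c * w).
    by rewrite alE; ring.
  rewrite ler_wpM2l//.
  have -> : y0 + (p%:R * s + w) = y + p%:R * (z + s) by rewrite /w; ring.
  have -> : y0 + w = y + p%:R * z by rewrite /w; ring.
  exact: max_z.
by move=> t; rewrite (aE t 0) mulr0 addr0.
Qed.

End PrimePower.

(** * Arithmetic and balls of the p-adic numbers *)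

Section PadicIntegers.
Variables (p : nat) (pr_p : prime p).
Local Notation Zp := (padic_int pr_p).
Implicit Types z t : Zp.

Let p_gt0 n : (0 < p ^ n)%N. Proof. by rewrite expn_gt0 prime_gt0. Qed.

Lemma residueD z t n : (z + t) n = ((z n + t n) %% p ^ n)%N. Proof. by []. Qed.
Lemma residueM z t n : (z * t) n = ((z n * t n) %% p ^ n)%N. Proof. by []. Qed.
Lemma residue1 n : (1 : Zp) n = (1 %% p ^ n)%N. Proof. by []. Qed.
Lemma residue0 n : (0 : Zp) n = 0%N. Proof. by rewrite /= mod0n. Qed.

Lemma residue_lt z n : (z n < p ^ n)%N.
Proof. by rewrite -residue_mod ltn_mod. Qed.

Lemma residue_nat m n : (m%:R : Zp) n = (m %% p ^ n)%N.
Proof.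
elim: m => [|m IHm]; first by rewrite mulr0n residue0 mod0n.
by rewrite mulrSr residueD IHm residue1 modnDm addn1.
Qed.

Lemma residue_subr z t n : ((z - t) n == 0%N) = (z n == t n).
Proof.
have -> : z n = (((z - t)%R n + t n) %% p ^ n)%N by rewrite -residueD subrK.
move: ((z - t) n) (residue_lt (z - t) n) => d lt_d.
rewrite -[X in _ = (_ == X)](modn_small (residue_lt t n)).
by rewrite -[X in _ = (_ == X %[mod _])]add0n eqn_modDr !modn_small.
Qed.

Lemma residue_eq0M z t n : z n = 0%N -> (z * t) n = 0%N.
Proof. by move=> z0; rewrite residueM z0 mul0n mod0n. Qed.

(** The quotient modulo p^m needs n more digits of z: its residue is z (m + n) / p^n. *)
Lemma padic_div_pow n z : z n = 0%N -> exists t, z = p%:R ^+ n * t.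
Proof.
move=> z0.
have dv m : (p ^ n %| z (m + n))%N.
  by rewrite /dvdn residue_mod_le ?leq_addl// z0.
have h m : ((z (m.+1 + n) %/ p ^ n = z (m + n) %/ p ^ n %[mod p ^ m]))%N.
  apply/eqP; rewrite -(eqn_pmul2l (p_gt0 n)) !muln_modr.
  rewrite ![(p ^ n * (_ %/ _))%N]mulnC !divnK// -expnD [(n + m)%N]addnC residue_mod.
  by rewrite addSn residueP.
exists (padic_of pr_p h); apply: padic_int_eq => m.
rewrite -natrX residueM residue_nat /= -(residue_mod_le z (leq_addr n m)).
by rewrite modnMml modnMmr mulnC divnK.
Qed.

End PadicIntegers.

Section PadicUnits.
Variables (p : nat) (pr_p : prime p).
Local Notation Zp := (padic_int pr_p).
Local Notation Qp := (padic pr_p).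
Local Notation iota := (@padic_of_int p pr_p).
Implicit Types z t : Zp.

(** If the zeroth digit is nonzero, all residues are prime to p, and Euler's theorem exhibits an
    inverse modulo p^n as a power of [z n]. Uniqueness of inverses makes these powers coherent. *)
Lemma padic_unitP z : reflect (z 1%N <> 0%N) (z \is a GRing.unit).
Proof.
apply: (iffP idP) => [uz z0|z1].
  have e : (z * z^-1)%R 1%N = (1 : Zp) 1%N by rewrite mulrV.
  by move: e; rewrite residue_eq0M// residue1 expn1 modn_small// prime_gt1.
have co n : coprime (z n) (p ^ n).
  case: n => [|n]; first by rewrite coprimen1.
  rewrite coprimeXr// coprime_sym prime_coprime//.
  have := residue_mod_le z (isT : (1 <= n.+1)%N); rewrite expn1 => zn.
  by apply/negP; rewrite /dvdn zn => /eqP.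
have euler n : (z n * z n ^ (totient (p ^ n)).-1 = 1 %[mod p ^ n])%N.
  by rewrite -expnS prednK ?totient_gt0 ?expn_gt0 ?prime_gt0// Euler_exp_totient.
have h n : (z n.+1 ^ (totient (p ^ n.+1)).-1
            = z n ^ (totient (p ^ n)).-1 %[mod p ^ n])%N.
  have := congr1 (modn^~ (p ^ n)%N) (euler n.+1).
  rewrite /= !modn_dvdm ?dvdn_exp2l// -modnMml residueP => e.
  transitivity ((z n * z n ^ (totient (p ^ n)).-1)
    * z n.+1 ^ (totient (p ^ n.+1)).-1 %% p ^ n)%N.
    by rewrite -[RHS]modnMml euler modnMml mul1n.
  by rewrite mulnAC -modnMml e modnMml mul1n.
apply/unitrP; exists (padic_of pr_p h).
suff e : z * padic_of pr_p h = 1 by rewrite mulrC.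
by apply: padic_int_eq => n; rewrite residueM residue1 /= modnMmr euler.
Qed.

Lemma padic_int_decomp z : z != 0 ->
  exists n (u : Zp), u \is a GRing.unit /\ z = p%:R ^+ n * u.
Proof.
move=> z0.
have [n] : exists n, z n != 0%N.
  apply: contrapT => /forallNP nz; case/eqP: z0.
  by apply: padic_int_eq => n; rewrite residue0; apply/eqP/negPn/negP.
(* Induction on the index of a nonzero residue, which division by p lowers by one. *)
elim: n z z0 => [|n IHn] z z0 zn.
  by move: (residue_lt z 0); rewrite expn0 ltnS leqn0 (negPf zn).
have [z1|/eqP z1] := eqVneq (z 1%N) 0%N; last first.
  by exists 0%N, z; rewrite expr0 mul1r; split=> //; exact/padic_unitP.
have [t zE] := padic_div_pow z1; rewrite expr1 in zE.
have t0 : t != 0 by apply: contraNneq z0 => t0; rewrite zE t0 mulr0.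
have [|m [u [uu tE]]] := IHn t t0; last first.
  by exists m.+1, u; split=> //; rewrite zE tE mulrA exprS.
apply: contraNneq zn => tn; have [s tE] := padic_div_pow tn.
by rewrite zE tE mulrA -exprS residue_eq0M// -natrX residue_nat modnn.
Qed.

HB.instance Definition _ :=
  GRing.RMorphism.copy iota (@tofrac (padic_int pr_p)).

Lemma padic_of_int_inj : injective iota.
Proof. by move=> z t /eqP; rewrite tofrac_eq => /eqP. Qed.

Lemma padic_prime_neq0 : p%:R != 0 :> Qp.
Proof.
rewrite -(rmorph_nat iota) -(rmorph0 iota) (inj_eq padic_of_int_inj).
apply/eqP => /(congr1 (fun t : Zp => t 2%N)) /eqP.
rewrite residue_nat residue0 -/(dvdn _ _) -{2}(expn1 p).
by rewrite dvdn_Pexp2l// prime_gt1.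
Qed.

End PadicUnits.

Lemma fraction_divE (R : idomainType) (x : {fraction R}) :
  exists a b : R, b != 0 /\ x = tofrac a / tofrac b.
Proof.
elim/quotW: x => r; exists (frac r).1, (frac r).2; split; first exact: denom_ratioP.
have d0 : tofrac (frac r).2 != 0 by rewrite tofrac_eq0 denom_ratioP.
apply: (mulIf d0); rewrite divfK//.
rewrite /tofrac -!lock -[LHS]/(FracField.mul _ _) !piE.
apply/eqmodP; rewrite /= FracField.equivfE /=.
rewrite !numden_Ratio ?mulf_neq0 ?denom_ratioP ?oner_eq0//.
by rewrite !mulr1 mulrC.
Qed.

Section PadicBalls.
Variables (p : nat) (pr_p : prime p).
Local Notation Zp := (padic_int pr_p).
Local Notation Qp := (padic pr_p).
Local Notation iota := (@padic_of_int p pr_p).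
Implicit Types (z t : Zp) (x y : Qp) (m n k : int).

Let p_neq0 := padic_prime_neq0 pr_p.

(** Unlike [padic_ball], the index ranges over all integers, so that the balls exhaust the field. *)
Definition zball n : set Qp := [set x | exists z, x = p%:R ^ n * iota z].

Definition coset_ball (x : Qp) n : set Qp := [set y | zball n (y - x)].

Lemma zball0 n : zball n 0.
Proof. by exists 0; rewrite rmorph0 mulr0. Qed.

Lemma zballN n x : zball n x -> zball n (- x).
Proof. by case=> z ->; exists (- z); rewrite rmorphN mulrN. Qed.

Lemma zballD n x y : zball n x -> zball n y -> zball n (x + y).
Proof. by case=> z -> [t ->]; exists (z + t); rewrite rmorphD mulrDr. Qed.

Lemma zballB n x y : zball n x -> zball n y -> zball n (x - y).
Proof. by move=> hx /zballN; exact: zballD. Qed.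

Lemma zballC n x y : zball n (x - y) -> zball n (y - x).
Proof. by move=> /zballN; rewrite opprB. Qed.

Lemma zballDl n x y : zball n x -> zball n (x + y) <-> zball n y.
Proof.
move=> hx; split=> [h|]; last exact: zballD.
by have := zballB h hx; rewrite addrC addKr.
Qed.

Lemma zballM m n x y : zball m x -> zball n y -> zball (m + n) (x * y).
Proof.
case=> z -> [t ->]; exists (z * t).
by rewrite rmorphM expfzDr//; ring.
Qed.

Lemma zball_int z : zball 0 (iota z).
Proof. by exists z; rewrite expr0z mul1r. Qed.

Lemma zball_exp n : zball n (p%:R ^ n).
Proof. by exists 1; rewrite rmorph1 mulr1. Qed.

Lemma zball_intM n z x : zball n x -> zball n (iota z * x).
Proof. by move=> h; rewrite -[n]add0r; apply: zballM => //; exact: zball_int. Qed.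

Lemma zball_le m n : m <= n -> zball n `<=` zball m.
Proof.
move=> le_mn x [z ->]; rewrite -[n](subrK m) expfzDr// mulrAC mulrC.
rewrite -[X in zball X]addr0; apply: zballM; first exact: zball_exp.
rewrite -subr_ge0 in le_mn; rewrite -(gez0_abs le_mn).
exists (p%:R ^+ `|n - m| * z).
by rewrite expr0z mul1r rmorphM rmorphXn rmorph_nat.
Qed.

Lemma zballMr k z n x : z \is a GRing.unit ->
  zball (k + n) (p%:R ^ k * iota z * x) <-> zball n x.
Proof.
move=> uz; split=> [h|]; last first.
  by move=> h; apply: zballM => //; exists z.
have -> : x = p%:R ^ (- k) * iota z^-1 * (p%:R ^ k * iota z * x).
  have e : iota z^-1 * iota z = 1 by rewrite -rmorphM mulVr// rmorph1.
  have := expfzDr (- k) k p_neq0; rewrite addNr expr0z => e'.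
  move: (iota z^-1) (iota z) (p%:R ^ (- k)) (p%:R ^ k) e e' => V U A B e e'.
  by transitivity ((V * U) * (A * B) * x); [rewrite e -e' !mul1r|ring].
by rewrite -[n](addKr k); apply: zballM => //; exists z^-1.
Qed.

Lemma zball_expM k n x : zball (k + n) (p%:R ^ k * x) <-> zball n x.
Proof. by have := zballMr k n x (unitr1 Zp); rewrite rmorph1 mulr1. Qed.

Lemma zball_residue (N : nat) z : zball N (iota z) <-> z N = 0%N.
Proof.
split=> [[t]|/padic_div_pow[t ->]].
  rewrite -exprnP -(rmorph_nat iota) -rmorphXn -rmorphM => /padic_of_int_inj ->.
  by rewrite residue_eq0M// -natrX residue_nat modnn.
by exists t; rewrite rmorphM rmorphXn rmorph_nat.
Qed.

Lemma zball_residueM k (N : nat) z :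
  zball (k + N%:Z) (p%:R ^ k * iota z) <-> z N = 0%N.
Proof. exact: iff_trans (zball_expM _ _ _) (zball_residue _ _). Qed.

(** Write x as a quotient of p-adic integers; only the power of p in the denominator, not its unit
    part, leaves Z_p. *)
Lemma zball_total x : exists n : nat, zball (- n%:Z) x.
Proof.
have [[a b] xE] : exists ab : Zp * Zp, ab.2 != 0 /\ x = iota ab.1 / iota ab.2.
  by have [a [b [b0 xE]]] := fraction_divE x; exists (a, b).
move: xE => [/= b0 ->].
have [n [u [uu ->]]] := padic_int_decomp b0.
exists n, (a * u^-1).
rewrite !rmorphM rmorphXn rmorph_nat rmorphV// invfM mulrCA -exprnN.
by rewrite mulrA.
Qed.

Lemma zball_cover k (N : nat) x : zball k x ->
  exists2 j, (j < p ^ N)%N & zball (k + N%:Z) (x - p%:R ^ k * j%:R).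
Proof.
case=> z ->; exists (z N); first exact: residue_lt.
rewrite -mulrBr -(rmorph_nat iota (z N)) -rmorphB; apply/zball_residueM.
by apply/eqP; rewrite residue_subr residue_nat residue_mod.
Qed.

(** Enumeration of the countable dense set of numbers p^-m j, with value 0 at indices that code no
    pair. *)
Definition padic_dense (i : nat) : Qp :=
  if unpickle i is Some (m, j) then p%:R ^ (- m%:Z) * j%:R else 0.

Lemma padic_denseP x (n : nat) : exists i, coset_ball (padic_dense i) n x.
Proof.
have [m xm] := zball_total x.
have [j _ xj] := zball_cover (m + n) xm.
exists (pickle (m, j)); rewrite /coset_ball /padic_dense pickleK /=.
by move: xj; rewrite PoszD addKr.
Qed.

End PadicBalls.

(** * Topology and Borel sets of the p-adic numbers *)

Section PadicTopology.
Variables (p : nat) (pr_p : prime p).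
Local Notation Zp := (padic_int pr_p).
Local Notation Qp := (padic pr_p).
Local Notation iota := (@padic_of_int p pr_p).
Implicit Types (x y : Qp) (m n : int) (A : set Qp).

Lemma nbhs_padicP x A :
  nbhs x A <-> exists n : nat, coset_ball x n `<=` A.
Proof.
rewrite nbhsP; split=> [[E [n nE] EA]|[n nA]].
  by exists n => y xy; apply: EA; apply/xsectionP; exact: nE.
exists [set xy : Qp * Qp | padic_ball n (xy.2 - xy.1)]; first by exists n.
by move=> y /xsectionP h; exact: nA.
Qed.

Lemma coset_ball_center x n : coset_ball x n x.
Proof. by rewrite /coset_ball/= subrr; exact: zball0. Qed.

Lemma coset_ball_trans n y x z :
  coset_ball x n y -> coset_ball y n z -> coset_ball x n z.
Proof.
by move=> xy yz; rewrite /coset_ball/= -(subrK y z) -addrA; exact: zballD.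
Qed.

Lemma coset_ball_sym n x y : coset_ball x n y -> coset_ball y n x.
Proof. exact: zballC. Qed.

Lemma coset_ball_eq n x y : coset_ball x n y -> coset_ball y n = coset_ball x n.
Proof.
move=> xy; apply/seteqP; split=> z; first exact: coset_ball_trans.
by apply: coset_ball_trans; exact: coset_ball_sym.
Qed.

Lemma coset_ball_le m n x : m <= n -> coset_ball x n `<=` coset_ball x m.
Proof. by move=> le_mn y; exact: zball_le. Qed.

Lemma open_coset_ball x n : open (coset_ball x n).
Proof.
rewrite openE => y xy; apply/nbhs_padicP; exists `|n|%N => z yz.
apply: coset_ball_trans xy _; apply: coset_ball_le yz; lia.
Qed.

Lemma measurable_coset_ball x n : measurable (coset_ball x n).
Proof. by apply: sub_sigma_algebra; exact: open_coset_ball. Qed.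

Lemma measurable_zball n : measurable (zball n : set Qp).
Proof.
suff -> : zball n = coset_ball (0 : Qp) n by exact: measurable_coset_ball.
by apply/seteqP; split=> x; rewrite /coset_ball/= subr0.
Qed.

(** A pi-system generating the Borel sets; the empty set is included for stability under
    intersection. *)
Definition ball_family : set (set Qp) :=
  [set A | A = set0 \/ exists x (n : nat), A = coset_ball x n].

(** Two balls that meet can be recentred at a common point, and are then nested. *)
Lemma setI_closed_ball_family : setI_closed ball_family.
Proof.
move=> A B [->|[x [m ->]]]; first by rewrite set0I; left.
move=> [->|[y [n ->]]]; first by rewrite setI0; left.
have [->|/set0P[z [xz yz]]] := eqVneq (coset_ball x m `&` coset_ball y n) set0.
  by left.
rewrite -(coset_ball_eq xz) -(coset_ball_eq yz).
right; exists z; have [le_mn|lt_nm] := leqP m n.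
  by exists n; rewrite setIidr//; apply: coset_ball_le; rewrite lez_nat.
by exists m; rewrite setIidl//; apply: coset_ball_le; rewrite lez_nat ltnW.
Qed.

(** The index codes a pair of a dense centre and a radius; balls that do not lie in A are replaced
    by the empty set. *)
Lemma open_bigcup_ball A : open A ->
  exists2 F : nat -> set Qp, (forall i, ball_family (F i)) & A = \bigcup_i F i.
Proof.
move=> oA.
exists (fun k : nat => if unpickle k is Some (i, n) then
  if `[< coset_ball (padic_dense pr_p i) (n : nat) `<=` A >]
  then coset_ball (padic_dense pr_p i) n else set0 else set0).
  move=> j; case: unpickle => [[i n]|]; last by left.
  by case: ifP => _; [right; exists (padic_dense pr_p i), n|left].
apply/seteqP; split=> [x Ax|x [j _]]; last first.
  by case: unpickle => [[i n]|]//; case: asboolP => // iA /iA.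
move: oA; rewrite openE => /(_ _ Ax) /nbhs_padicP[n nA].
have [i xi] := padic_denseP x n.
exists (pickle (i, n)) => //; rewrite pickleK.
by rewrite -(coset_ball_eq xi); case: asboolP => // _; exact: coset_ball_center.
Qed.

Lemma measurable_ball_family : measurable = <<s ball_family >>.
Proof.
apply/seteqP; split=> A.
  apply: smallest_sub; first exact: smallest_sigma_algebra.
  move=> {}A /open_bigcup_ball[F ballF ->].
  by apply: sigma_algebra_bigcup => i; exact: sub_gen_smallest.
apply: smallest_sub; first exact: sigma_algebra_measurable.
move=> B [->|[x [n ->]]]; first exact: measurable0.
exact: measurable_coset_ball.
Qed.

Lemma measurable_fun_continuous d (T : measurableType d) (f : T -> Qp) :
  (forall x (n : nat), measurable (f @^-1` coset_ball x n)) ->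
  measurable_fun setT f.
Proof.
move=> mf; apply: (@measurability _ _ _ _ _ _ ball_family).
  exact: measurable_ball_family.
move=> _ [A [->|[x [n ->]]] <-]; rewrite setTI; first by rewrite preimage_set0.
exact: mf.
Qed.

(** Balls form a generating pi-system, and the countably many cosets of Z_p centred at dense points
    cover the space with finite mass. *)
Lemma padic_measure_unique (R : realType) (mu nu : probability Qp R) :
  (forall x (n : nat), mu (coset_ball x n) = nu (coset_ball x n)) ->
  forall A, measurable A -> mu A = nu A.
Proof.
move=> h A mA.
apply: (measure_unique ball_family
  (fun i : nat => if unpickle i is Some j
     then coset_ball (padic_dense pr_p j) 0 else set0)) => //.
- exact: measurable_ball_family.
- exact: setI_closed_ball_family.
- move=> i; case: unpickle => [j|]; last by left.
  by right; exists (padic_dense pr_p j), 0%N.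
- apply/seteqP; split=> // x _; have [i xi] := padic_denseP x 0.
  by exists (pickle i) => //=; rewrite pickleK; exact: xi.
- by move=> B [->|[x [n ->]]]; [rewrite !measure0|exact: h].
move=> i; case: unpickle => [j|]; last by rewrite measure0.
rewrite (le_lt_trans (probability_le1 _ _)) ?ltry//.
exact: measurable_coset_ball.
Qed.

Lemma measurable_affine (a b : Qp) : measurable_fun setT (fun x : Qp => a * x + b).
Proof.
apply: measurable_fun_continuous => x n.
suff : open ((fun y : Qp => a * y + b) @^-1` coset_ball x n).
  exact: sub_sigma_algebra.
rewrite openE => y xy; apply/nbhs_padicP.
have [m am] := zball_total a.
exists (m + n)%N => z yz; rewrite /= in xy *.
apply: coset_ball_trans xy _; rewrite /coset_ball/=.
have -> : a * z + b - (a * y + b) = a * (z - y) by ring.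
have := zballM am yz; by rewrite PoszD addKr.
Qed.

Lemma measurable_add d (T : measurableType d) (f g : T -> Qp) :
  measurable_fun setT f -> measurable_fun setT g ->
  measurable_fun setT (fun t => f t + g t).
Proof.
move=> mf mg; apply: measurable_fun_continuous => x n.
(* The sum lies in the coset of x exactly when, for some dense point d, f lies in the coset of d and
   g in that of x - d. *)
rewrite (_ : _ @^-1` _ = \bigcup_i (f @^-1` coset_ball (padic_dense pr_p i) n `&`
   g @^-1` coset_ball (x - padic_dense pr_p i) n)).
  apply: bigcup_measurable => i _; apply: measurableI.
    by rewrite -[X in measurable X]setTI; apply: mf => //; exact: measurable_coset_ball.
  by rewrite -[X in measurable X]setTI; apply: mg => //; exact: measurable_coset_ball.
apply/seteqP; split=> t /=; rewrite /coset_ball/=.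
  move=> xt; have [i fi] := padic_denseP (f t) n; exists i => //; split=> //=.
  have := zballB xt fi.
  by rewrite /coset_ball/=; congr zball; ring.
move=> [i _ [/= fi gi]]; have := zballD fi gi.
by rewrite /coset_ball/=; congr zball; ring.
Qed.

End PadicTopology.

(** * Compactness of balls *)

Section Compactness.
Variables (p : nat) (pr_p : prime p).
Local Notation Zp := (padic_int pr_p).
Local Notation Qp := (padic pr_p).
Local Notation iota := (@padic_of_int p pr_p).
Implicit Types (x y : Qp) (k : int).

Lemma ultra_bigcup_ord (T : Type) (F : set_system T) (B : nat -> set T) m :
  UltraFilter F -> F (\bigcup_(j in `I_m) B j) -> exists2 j, (j < m)%N & F (B j).
Proof.
move=> UF; elim: m => [|m IHm] FB.
  by case: (@filter_not_empty _ F _); rewrite II0 bigcup_set0 in FB.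
have [FBm|FBm] := in_ultra_setVsetC (B m) UF; first by exists m.
have [|j jm FBj] := IHm; last by exists j; rewrite // ltnW.
apply: filterS (filterI FB FBm) => x [[j /= jm Bjx] nBmx].
exists j => //=; move: jm; rewrite ltnS leq_eqVlt => /orP[/eqP jm|//].
by case: nBmx; rewrite -jm.
Qed.

(** For every N an ultrafilter on p^k Z_p selects one of the p^N cosets of p^(k+N) Z_p. The selected
    cosets meet pairwise, so their labels are coherent and define a p-adic integer z; the
    ultrafilter converges to p^k z. *)
Lemma compact_zball k : compact (zball k : set Qp).
Proof.
rewrite compact_ultra => F UF Fk.
have /choice[f Ff] (N : nat) :
    exists j : nat, F (coset_ball (p%:R ^ k * j%:R : Qp) (k + N%:Z)).
  have [|j _ Fj] := @ultra_bigcup_ord _ F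
    (fun j => coset_ball (p%:R ^ k * j%:R : Qp) (k + N%:Z)) (p ^ N) UF.
    apply: filterS Fk => x /(zball_cover N)[j jN xj]; by exists j.
  by exists j.
have h N : (f N.+1 = f N %[mod p ^ N])%N.
  have [x [xN xN1]] := filter_ex (filterI (Ff N) (Ff N.+1)).
  have := coset_ball_trans xN (coset_ball_le _ (coset_ball_sym xN1)).
  rewrite /coset_ball /= -mulrBr -!(rmorph_nat iota (f _)) -rmorphB.
  move=> /(_ _)/zball_residueM -/(_ _)/eqP.
  by rewrite residue_subr !residue_nat => H; apply/eqP/H; rewrite lerD2l lez_nat.
pose z := padic_of pr_p h.
exists (p%:R ^ k * iota z); split; first by exists z.
move=> A /nbhs_padicP[n nA].
have zf : coset_ball (p%:R ^ k * iota z) (k + `|n%:Z - k|%N%:Z)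
     = coset_ball (p%:R ^ k * (f `|n%:Z - k|%N)%:R) (k + `|n%:Z - k|%N%:Z).
  apply: coset_ball_eq; rewrite /coset_ball /= -mulrBr.
  rewrite -(rmorph_nat iota (f _)) -rmorphB; apply/zball_residueM/eqP.
  by rewrite residue_subr residue_nat.
apply: filterS (Ff `|n%:Z - k|%N) => x; rewrite -zf => xz; apply: nA.
apply: coset_ball_le xz; lia.
Qed.

Lemma compact_subgroup_zball k : compact_subgroup (zball k : set Qp).
Proof.
split; [exact: compact_zball|exact: zball0|by move=> x y; exact: zballB].
Qed.

Lemma bigcap_zball x : (forall n : nat, zball n x) -> x = 0.
Proof.
move=> hx; have [n [z xE]] := zball_total x; rewrite xE.
suff -> : z = 0 by rewrite rmorph0 mulr0.
apply: padic_int_eq => N; rewrite residue0; apply/(zball_residueM (- n%:Z)).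
by rewrite -xE; apply: zball_le (hx N); lia.
Qed.

Lemma measurable_padic_set1 x : measurable [set x].
Proof.
rewrite (_ : [set x] = \bigcap_(n : nat) coset_ball x n).
  by apply: bigcapT_measurable => n; exact: measurable_coset_ball.
apply/seteqP; split=> y; first by move=> -> n _; exact: coset_ball_center.
by move=> h; apply/subr0_eq/bigcap_zball => n; exact: h.
Qed.

Lemma compact_subgroup0 : compact_subgroup [set (0 : Qp)].
Proof.
split=> //; first exact: compact_set1.
by move=> x y -> ->; rewrite /= subr0.
Qed.

(** Named so that it can carry a measurable-function structure and push probabilities forward. *)
Definition affine_map (a b x : Qp) : Qp := a * x + b.

HB.instance Definition _ (a b : Qp) := isMeasurableFun.Build _ _ Qp Qp
  (affine_map a b) (measurable_affine a b).

Lemma affine_map1 b x : affine_map 1 b x = x + b.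
Proof. by rewrite /affine_map mul1r. Qed.

Lemma preimage_affine_map1 b (A : set Qp) :
  affine_map 1 b @^-1` A = [set x | A (x + b)].
Proof. by apply/funext => x; rewrite /preimage/= affine_map1. Qed.

End Compactness.

(** * Criteria for idempotent distributions *)

Section Idempotent.
Variables (R : realType) (p : nat) (pr_p : prime p).
Local Notation Qp := (padic pr_p).
Implicit Types (mu : probability Qp R) (x : Qp) (k : int) (K : set Qp).

Lemma measurable_translate x (A : set Qp) :
  measurable A -> measurable [set y | A (x + y)].
Proof.
move=> mA; rewrite (_ : mkset _ = setT `&` (fun y => 1 * y + x) @^-1` A).
  exact: measurable_affine.
by rewrite setTI; apply/funext => y; rewrite /preimage /= mul1r addrC.
Qed.

(** The translate of [mu] by - x0 is carried by K and K-invariant, hence is the Haar measure of K,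
    and [mu] is its shift by x0. *)
Lemma idempotent_of_invariant mu K x0 : compact_subgroup K ->
  measurable K -> mu [set y | K (y - x0)] = 1%E ->
  (forall x A, K x -> measurable A -> mu [set y | A (x + y)] = mu A) ->
  idempotent_distribution mu.
Proof.
move=> cK mK muK inv.
pose m : probability Qp R := distribution mu (affine_map 1 (- x0)).
have mE A : m A = mu [set y | A (y - x0)].
  by rewrite -preimage_affine_map1.
exists K, m, x0; split=> //.
  split; first by rewrite mE.
  move=> x A Kx mA; rewrite !mE -(inv x [set y | A (y - x0)] Kx); last first.
    under eq_set do rewrite addrC.
    exact: measurable_translate.
  by congr (mu _); apply/funext => y /=; rewrite addrA.
move=> A mA; rewrite /convolution.
under eq_integral do rewrite diracE.
have mA' := measurable_translate x0 mA.
transitivity (\int[m]_x (\1_[set y | A (x0 + y)] x)%:E)%E; last first.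
  apply: eq_integral => x _; rewrite indicE; congr ((_ : bool)%:R%:E).
  by apply/idP/idP => /set_mem h; apply/mem_set; rewrite /= addrC.
rewrite integral_indic// setIT.
transitivity (mu [set y | [set y | A (x0 + y)] (y - x0)]); last exact/esym/mE.
congr (mu _).
by apply/funext => y /=; rewrite addrC subrK.
Qed.

Lemma idempotent_of_degenerate mu :
  degenerate_distribution mu -> idempotent_distribution mu.
Proof.
move=> [x0 mu0].
have m0 := @measurable_padic_set1 p pr_p 0.
apply: (@idempotent_of_invariant _ [set 0] x0) => //.
- exact: compact_subgroup0.
- rewrite mu0; first by rewrite diracE mem_set//= subrr.
  under eq_set do rewrite addrC.
  exact: (measurable_translate (- x0) m0).
- by move=> _ A -> mA; congr (mu _); apply/funext => y /=; rewrite add0r.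
Qed.

(** It is enough to compare [mu] with its translate on balls. A ball of index at most k is fixed by
    the translation; a smaller ball inside x0 + p^k Z_p is covered by uniformity; a smaller one
    outside is null, and so is its translate. *)
Lemma invariant_of_uniform mu x0 k :
  mu (coset_ball x0 k) = 1%E ->
  (forall (N : nat) u v, zball k u -> zball k v ->
    mu (coset_ball (x0 + u) (k + N%:Z)) = mu (coset_ball (x0 + v) (k + N%:Z))) ->
  forall x A, zball k x -> measurable A -> mu [set y | A (x + y)] = mu A.
Proof.
move=> mu1 unif x A kx mA.
pose nu : probability Qp R := distribution mu (affine_map 1 x).
transitivity (nu A).
  by under eq_set do rewrite addrC; rewrite -preimage_affine_map1.
apply: padic_measure_unique => // w n.
have -> : nu (coset_ball w n) = mu (coset_ball (w - x) n).
  rewrite [LHS](_ : _ = mu [set y | coset_ball w n (y + x)]).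
    congr (mu _); apply/funext => y; rewrite /coset_ball /=.
    by congr zball; ring.
  by rewrite -preimage_affine_map1.
have [le_nk|lt_kn] := lerP n%:Z k.
  congr (mu _); apply: coset_ball_eq.
  rewrite /coset_ball /= addrAC subrr add0r; apply: zballN.
  exact: zball_le kx.
have -> : (n%:Z = k + `|n%:Z - k|%N) by lia.
have [kw|nkw] := pselect (zball k (w - x0)).
  have := unif `|n%:Z - k|%N (w - x0 - x) (w - x0).
  have -> : x0 + (w - x0 - x) = w - x by ring.
  have -> : x0 + (w - x0) = w by ring.
  by apply=> //; exact: zballB.
have null w' : ~ zball k (w' - x0) ->
    mu (coset_ball w' (k + `|n%:Z - k|%N)) = 0%E.
  move=> nkw'; apply/eqP; rewrite eq_le measure_ge0 andbT.
  have mk := measurable_coset_ball x0 k.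
  have <- : mu (~` coset_ball x0 k) = 0%E.
    by rewrite probability_setC// mu1 subee.
  apply: le_measure; rewrite ?inE; first exact: measurable_coset_ball.
    exact: measurableC.
  move=> y w'y x0y; apply: nkw'.
  apply: coset_ball_trans x0y (coset_ball_sym (coset_ball_le _ w'y)).
  by rewrite lerDl.
rewrite !null// => h; apply: nkw.
by have := zballD h kx; congr zball; ring.
Qed.

Lemma idempotent_of_uniform mu x0 k :
  mu (coset_ball x0 k) = 1%E ->
  (forall (N : nat) u v, zball k u -> zball k v ->
    mu (coset_ball (x0 + u) (k + N%:Z)) = mu (coset_ball (x0 + v) (k + N%:Z))) ->
  idempotent_distribution mu.
Proof.
move=> mu1 unif; apply: (@idempotent_of_invariant _ (zball k) x0) => //.
- exact: compact_subgroup_zball.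
- exact: measurable_zball.
- exact: invariant_of_uniform mu1 unif.
Qed.

End Idempotent.

(** * Concentration of independent linear forms *)

Section RealProbability.
Variables (R : realType) (d : measure_display) (T : measurableType d).
Variable P : probability T R.
Implicit Types A B : set T.

(** Real-valued probabilities, to which field and linear arithmetic apply. *)
Definition pr A : R := fine (P A).

Lemma prE A : measurable A -> P A = (pr A)%:E.
Proof. by move=> mA; rewrite fineK// fin_num_measure. Qed.

Lemma pr_ge0 A : 0 <= pr A.
Proof. exact: fine_ge0. Qed.

Lemma pr_le A B : measurable A -> measurable B -> A `<=` B -> pr A <= pr B.
Proof.
by move=> mA mB AB; rewrite -lee_fin -!prE// le_measure// inE.
Qed.

Lemma pr_le1 A : measurable A -> pr A <= 1.
Proof. by move=> mA; rewrite -lee_fin -prE// probability_le1. Qed.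

Lemma prC A : measurable A -> pr (~` A) = 1 - pr A.
Proof.
move=> mA; apply/EFin_inj; rewrite -prE; last exact: measurableC.
by rewrite probability_setC// prE.
Qed.

Lemma prU A B : measurable A -> measurable B -> pr (A `|` B) <= pr A + pr B.
Proof.
move=> mA mB; rewrite -lee_fin EFinD -!prE//; last exact: measurableU.
exact: measureU2.
Qed.

Lemma prT : pr setT = 1.
Proof. by rewrite /pr probability_setT. Qed.

Lemma pr_set0 : pr set0 = 0.
Proof. by rewrite /pr measure0. Qed.

Lemma pr_null A B : measurable A -> measurable B -> A `<=` B -> pr B = 0 -> pr A = 0.
Proof.
by move=> mA mB AB B0; apply/le_anti; rewrite pr_ge0 andbT -B0 pr_le.
Qed.

Lemma pr_full A B : measurable A -> measurable B -> A `<=` B -> pr A = 1 -> pr B = 1.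
Proof.
by move=> mA mB AB A1; apply/le_anti; rewrite pr_le1//= -A1 pr_le.
Qed.

Lemma pr_eq1 A : measurable A -> P A = 1%E <-> pr A = 1.
Proof. by move=> mA; rewrite prE//; split=> [[]//|->]. Qed.

Lemma prI1 A B : measurable A -> measurable B -> pr A = 1 -> pr (A `&` B) = pr B.
Proof.
move=> mA mB A1.
have mAB : measurable (A `&` B) by exact: measurableI.
apply/le_anti; rewrite (pr_le mAB mB (@subIsetr _ _ _))/=.
rewrite (le_trans (pr_le mB (measurableU _ _ mAB (measurableC mA)) _))//.
  by move=> x Bx; have [Ax|nAx] := pselect (A x); [left|right].
by rewrite (le_trans (prU _ _))// ?prC ?A1 ?subrr ?addr0//; exact: measurableC.
Qed.

End RealProbability.

Section IndependentForms.
Variables (R : realType) (p : nat) (pr_p : prime p).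
Variables (d : measure_display) (T : measurableType d) (P : probability T R).
Local Notation Qp := (padic pr_p).
Local Notation pr := (pr P).
Implicit Types (X Y L : T -> Qp).

Lemma measurable_event X (A : set Qp) :
  measurable_fun setT X -> measurable A -> measurable (X @^-1` A).
Proof. by move=> mX mA; rewrite -[X in measurable X]setTI; exact: mX. Qed.

Lemma independent_pr X Y (A B : set Qp) : independent_rv P X Y ->
  measurable A -> measurable B ->
  pr (X @^-1` A `&` Y @^-1` B) = pr (X @^-1` A) * pr (Y @^-1` B).
Proof.
move=> [mX mY XY] mA mB; apply/EFin_inj; rewrite EFinM -!prE ?XY//;
  do ?[exact: measurable_event|apply: measurableI].
Qed.

(** Continuity from below along the balls p^-n Z_p, which increase to the whole field. *)
Lemma pr_zball_cvg X (e : R) : measurable_fun setT X -> 0 < e ->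
  exists n0 : nat, forall n : nat, (n0 <= n)%N ->
    1 - e < pr (X @^-1` zball (- n%:Z)).
Proof.
move=> mX e0; pose F (n : nat) := X @^-1` (zball (- n%:Z)).
have mF n : measurable (F n).
  by apply: measurable_event => //; exact: measurable_zball.
have FT : \bigcup_n F n = setT.
  apply/seteqP; split=> // w _; have [n Xn] := zball_total (X w).
  by exists n.
have ndF : nondecreasing_seq F.
  move=> m n mn; apply/subsetPset => w; apply: zball_le; rewrite lerN2 lez_nat//.
have cv := @nondecreasing_cvg_mu _ _ _ P F mF (bigcupT_measurable _ mF) ndF.
have PT : P (\bigcup_n F n) = 1%E by rewrite FT; exact: probability_setT.
have {cv} : P \o F @ \oo --> (1%:E : \bar R) by rewrite -[X in _ --> X]PT.
move=> /fine_cvg.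
move/cvgrPdist_lt => /(_ e e0)[n0 _ h].
exists n0 => n n0n; have := h n n0n; rewrite /= ltr_norml => /andP[_].
rewrite ltrBlDr => h'; rewrite ltrBlDr addrC; exact: h'.
Qed.

Variables (alpha : Qp) (kap : nat).
Hypothesis alphaP : forall n x, zball (n + kap%:Z) (alpha * x) <-> zball n x.

(* With a = P(X notin p^m Z_p) and b = P(Y notin p^(m - kap) Z_p), the ultrametric
   inequality bounds both a (1 - o(1)) and b (1 - o(1)) by
   P(L1 notin p^m Z_p) P(L2 notin p^m Z_p) = o(1) (a + b), so a = b = 0. *)
Lemma bounded_of_independent_forms X Y : independent_rv P X Y ->
  independent_rv P (fun w => X w + Y w) (fun w => X w + alpha * Y w) ->
  exists m : int, pr (X @^-1` zball m) = 1 /\ pr (Y @^-1` zball m) = 1.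
Proof.
move=> indXY indL; have [mX mY _] := indXY; have [mL1 mL2 _] := indL.
have e0 : 0 < 16^-1 :> R by rewrite invr_gt0.
have [n1 hX] := pr_zball_cvg mX e0; have [n2 hY] := pr_zball_cvg mY e0.
set m : int := - (maxn n1 n2)%:Z.
have {hX} := hX _ (leq_maxl n1 n2); have {hY} := hY _ (leq_maxr n1 n2).
rewrite -/m => hY hX.
have mz k : measurable (zball k : set Qp)  by exact: measurable_zball.
have mzC k : measurable (~` zball k : set Qp) := measurableC (mz k).
set m' := m - kap%:Z.
have alm y : zball m (alpha * y) <-> zball m' y.
  by have := alphaP m' y; rewrite subrK.
have m'm (y : Qp) : zball m y -> zball m' y by apply: zball_le; rewrite /m'; lia.
set a := pr (X @^-1` zball m) in hX *.
set b' := pr (Y @^-1` zball m) in hY.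
set b := pr (Y @^-1` zball m').
have [mXm mYm mYm'] : [/\ measurable (X @^-1` zball m), measurable (Y @^-1` zball m)
   & measurable (Y @^-1` zball m')].
  by split; exact: measurable_event.
have XC : pr (X @^-1` (~` zball m)) = 1 - a by exact: prC.
have YC : pr (Y @^-1` (~` zball m')) = 1 - b by exact: prC.
have hXY2 := independent_pr indXY (mzC m) (mz m); rewrite XC in hXY2.
have hXY1 := independent_pr indXY (mz m) (mzC m'); rewrite YC in hXY1.
have hL := independent_pr indL (mzC m) (mzC m).
pose L1 := (fun w => X w + Y w); pose L2 := (fun w => X w + alpha * Y w).
pose c := pr (L1 @^-1` (~` zball m)); pose e := pr (L2 @^-1` (~` zball m)).
have le1 : b' <= b by apply: pr_le => // w; exact: m'm.
have [a1 b1] : a <= 1 /\ b <= 1 by split; exact: pr_le1.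
have c_le : c <= (1 - a) + (1 - b').
  rewrite -!prC// (le_trans _ (prU _ _ _))//; [|exact: measurableC..].
  apply: pr_le; [exact: measurable_event|by apply: measurableU; exact: measurableC|].
  move=> w; rewrite /L1 /= => nL; apply/not_andP => -[Xm Ym].
  by apply: nL; exact: zballD.
have e_le : e <= (1 - a) + (1 - b).
  rewrite -!prC// (le_trans _ (prU _ _ _))//; [|exact: measurableC..].
  apply: pr_le; [exact: measurable_event|by apply: measurableU; exact: measurableC|].
  move=> w; rewrite /L2 /= => nL; apply/not_andP => -[Xm Ym].
  by apply: nL; apply: zballD => //; exact/alm.
(* When one variable is in its ball and the other is not, neither form lies in p^m Z_p. The pair of
   balls is (m, m) here and (m, m') in [h1]. *)
have h2 : (1 - a) * b' <= c * e.
  rewrite -hXY2 -hL; apply: pr_le.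
  - by apply: measurableI => //; exact: measurableC.
  - by apply: measurableI; apply: measurable_event.
  move=> w [/= nX Ym]; split; rewrite /L1 /L2 /= => h; apply: nX.
    by have := zballB h Ym; rewrite addrK.
  by have := zballB h ((alm _).2 (m'm _ Ym)); rewrite addrK.
have h1 : a * (1 - b) <= c * e.
  rewrite -hXY1 -hL; apply: pr_le.
  - by apply: measurableI => //; exact: measurableC.
  - by apply: measurableI; apply: measurable_event.
  move=> w [/= Xm nY]; split; rewrite /L1 /L2 /= => h; apply: nY.
    by apply: m'm; have := zballB h Xm; rewrite addrAC subrr add0r.
  by apply/alm; have := zballB h Xm; rewrite addrAC subrr add0r.
have [c0 e0'] : 0 <= c /\ 0 <= e by split; exact: pr_ge0.
have [a1' b1'] : a = 1 /\ b = 1.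
  (* With the tolerance 1/16, c is at most 1/8. Adding the two bounds below gives 15/16 S <= 1/4 S
     for S = (1 - a) + (1 - b) >= 0, so S = 0. *)
  have : c * e <= 8^-1 * ((1 - a) + (1 - b)).
    apply: ler_pM => //; lra.
  have : (1 - 16^-1) * (1 - b) <= a * (1 - b) by rewrite ler_wpM2r ?subr_ge0// ltW.
  have : (1 - 16^-1) * (1 - a) <= (1 - a) * b'.
    by rewrite [leRHS]mulrC ler_wpM2r ?subr_ge0// ltW.
  move: h1 h2; set ce := c * e; set u := a * (1 - b); set v := (1 - a) * b'.
  by move=> h1 h2 h3 h4 h5; split; lra.
exists m'; split=> //; apply: pr_full a1' => //; first exact: measurable_event.
by move=> w; exact: m'm.
Qed.

End IndependentForms.

(** * Concentration in a single coset *)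

Section Concentration.
Variables (R : realType) (p : nat) (pr_p : prime p).
Variables (d : measure_display) (T : measurableType d) (P : probability T R).
Local Notation Qp := (padic pr_p).
Local Notation Zp := (padic_int pr_p).
Local Notation iota := (@padic_of_int p pr_p).
Local Notation pr := (pr P).
Implicit Types (X Y L : T -> Qp) (k n : int).

Lemma measurable_event_ball X x n :
  measurable_fun setT X -> measurable (X @^-1` coset_ball x n).
Proof. by move=> mX; apply: measurable_event => //; exact: measurable_coset_ball. Qed.

Lemma pr0_cover (A : set T) (B : nat -> set T) : measurable A ->
  (forall i, measurable (B i)) -> (forall i, pr (B i) = 0) ->
  A `<=` \bigcup_i B i -> pr A = 0.
Proof.
move=> mA mB B0 AB.
have : P.-negligible (\bigcup_i B i).
  by apply: negligible_bigcup => i; apply/negligibleP => //;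
    rewrite -[0%E]/(0%:E) -(B0 i); exact: prE.
move=> [C [mC C0 BC]]; apply: (pr_null mA mC (subset_trans AB BC)).
by apply/EFin_inj; rewrite -prE.
Qed.

Definition concentrated X k := exists x, pr (X @^-1` coset_ball x k) = 1.

Lemma concentrated_le X k n : measurable_fun setT X -> k <= n ->
  concentrated X n -> concentrated X k.
Proof.
move=> mX le_kn [x x1]; exists x; apply: pr_full x1.
- exact: measurable_event_ball.
- exact: measurable_event_ball.
- by move=> w; exact: coset_ball_le.
Qed.

(** Countably many cosets cover the field, so they cannot all be null. Dense points are taken at
    level |n|, a natural number at least n. *)
Lemma exists_charged_coset X n : measurable_fun setT X ->
  exists x, pr (X @^-1` coset_ball x n) != 0.
Proof.
move=> mX; apply: contrapT => /forallNP h.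
have : pr setT = 0.
  apply: (@pr0_cover _ (fun i => X @^-1` coset_ball (padic_dense pr_p i) `|n|%N)).
  - exact: measurableT.
  - by move=> i; exact: measurable_event_ball.
  - move=> i; have /negP/negPn/eqP := h (padic_dense pr_p i).
    apply: pr_null; [exact: measurable_event_ball..|].
    by move=> w; apply: coset_ball_le; lia.
  - by move=> w _; have [i Xi] := padic_denseP (X w) `|n|%N; exists i.
by rewrite prT => /eqP; rewrite oner_eq0.
Qed.

(** Off the null set [N] on which X leaves one of the chosen balls, any two values of X agree modulo
    every p^n. *)
Lemma concentrated_degenerate X (mu : probability Qp R) :
  measurable_fun setT X -> (forall A, measurable A -> mu A = P (X @^-1` A)) ->
  (forall k, concentrated X k) -> degenerate_distribution mu.
Proof.
move=> mX muE hc.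
have /choice[x x1] (n : nat) : exists x, pr (X @^-1` coset_ball x n) = 1.
  exact: hc.
pose N := \bigcup_(n : nat) (X @^-1` (~` coset_ball (x n) n)).
have mN : measurable N.
  by apply: bigcup_measurable => n _; apply: measurable_event => //;
    apply: measurableC; exact: measurable_coset_ball.
have N0 : pr N = 0.
  apply: (@pr0_cover N (fun n : nat => X @^-1` (~` coset_ball (x n) n))) => // n.
    by apply: measurable_event => //; apply: measurableC; exact: measurable_coset_ball.
  rewrite (_ : _ @^-1` _ = ~` (X @^-1` coset_ball (x n) n))//.
  by rewrite prC ?x1 ?subrr//; exact: measurable_event_ball.
have NC : pr (~` N) = 1 by rewrite prC// N0 subr0.
have [w0 Nw0] : exists w, ~ N w.
  apply: contrapT => /forallNP h; have : pr (~` N) = 0.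
    rewrite (_ : ~` N = set0); first exact: pr_set0.
    by apply/seteqP; split=> // w; exact: h.
  by rewrite NC => /eqP; rewrite oner_eq0.
have XE w : ~ N w -> X w = X w0.
  move=> Nw; apply/subr0_eq/bigcap_zball => n.
  have h w' : ~ N w' -> coset_ball (x n) n (X w').
    by move=> Nw'; apply: contrapT => h; apply: Nw'; exists n.
  exact: coset_ball_trans (coset_ball_sym (h _ Nw0)) (h _ Nw).
exists (X w0) => A mA; rewrite muE// diracE.
have mXA : measurable (X @^-1` A) by exact: measurable_event.
rewrite prE//; congr _%:E; have [Aw0|nAw0] := boolP (X w0 \in A).
  apply: pr_full NC => //; first exact: measurableC.
  by move=> w /XE; rewrite /= => ->; exact/set_mem.
apply: pr_null N0 => // w /= Aw; apply: contrapT => /XE Xw; move/negP: nAw0; apply.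
by apply/mem_set; rewrite -Xw.
Qed.

(** A zero-one law: [E] and [F] coincide almost surely and are independent, so [pr E] equals its
    square; being nonzero, it is 1. *)
Lemma concentrated_of_congruent X Y n s (Z : set T) : independent_rv P X Y ->
  measurable Z -> pr Z = 1 -> (forall w, Z w -> zball n (X w - Y w - s)) ->
  concentrated X n.
Proof.
move=> indXY mZ Z1 hZ; have [mX mY _] := indXY.
have [x x0] := exists_charged_coset n mX.
set E := X @^-1` coset_ball x n in x0.
pose F := Y @^-1` coset_ball (x - s) n.
have mE : measurable E by exact: measurable_event_ball.
have mF : measurable F by exact: measurable_event_ball.
have ZEF w : Z w -> E w <-> F w.
  move=> /hZ Zw; rewrite /E /F /coset_ball /=.
  have -> : X w - x = (X w - Y w - s) + (Y w - (x - s)) by ring.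
  exact: zballDl.
have EF : pr E = pr F.
  rewrite -(prI1 mZ mE Z1) -(prI1 mZ mF Z1); congr pr.
  by apply/seteqP; split=> w [Zw /(ZEF w Zw)].
have EEF : pr E = pr (E `&` F).
  rewrite -(prI1 mZ mE Z1) -(prI1 mZ (measurableI _ _ mE mF) Z1); congr pr.
  apply/seteqP; split=> w [Zw]; last by case.
  by move=> Ew; split=> //; split=> //; exact/ZEF.
exists x; apply: (mulIf x0); rewrite mul1r -/E {3}EEF independent_pr//.
- by rewrite -/E -/F -EF.
- exact: measurable_coset_ball.
- exact: measurable_coset_ball.
Qed.

(** When Y falls in a charged coset of y, the sum determines the coset of X. By independence, X
    avoids the coset of z - y with probability 0. *)
Lemma concentrated_of_sum X Y n : independent_rv P X Y ->
  concentrated (fun w => X w + Y w) n -> concentrated X n.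
Proof.
move=> indXY [z z1]; have [mX mY _] := indXY.
have [y y0] := exists_charged_coset n mY.
exists (z - y); have mXzy := measurable_event_ball (z - y) n mX.
have mS : measurable ((fun w => X w + Y w) @^-1` coset_ball z n).
  by apply: measurable_event_ball; exact: measurable_add.
have : pr (X @^-1` (~` coset_ball (z - y) n) `&` Y @^-1` coset_ball y n) = 0.
  have : pr (~` ((fun w => X w + Y w) @^-1` coset_ball z n)) = 0.
    by rewrite prC// z1 subrr.
  apply: pr_null; [|exact: measurableC|].
    apply: measurableI; last exact: measurable_event_ball.
    by apply: measurable_event => //; apply: measurableC; exact: measurable_coset_ball.
  move=> w [/= nX Yy] Sz; apply: nX; rewrite /coset_ball /= in Yy Sz *.
  by have := zballB Sz Yy; congr zball; ring.
rewrite independent_pr//; [|apply: measurableC|]; [|exact: measurable_coset_ball..].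
move=> /eqP; rewrite mulf_eq0 (negPf y0) orbF preimage_setC prC// subr_eq0.
by move=> /eqP <-.
Qed.

Lemma independent_rvC X Y : independent_rv P X Y -> independent_rv P Y X.
Proof.
by move=> [mX mY XY]; split=> // A B mA mB; rewrite setIC XY// muleC.
Qed.

(** The difference of the two forms is (1 - alpha) Y: the factor 1 - alpha gains one power of p over
    the concentration of Y. *)
Lemma concentrated_step alpha X Y k : zball 1 (alpha - 1) ->
  independent_rv P X Y ->
  independent_rv P (fun w => X w + Y w) (fun w => X w + alpha * Y w) ->
  concentrated Y k ->
  concentrated X (k + 1) /\ concentrated Y (k + 1).
Proof.
move=> al1 indXY indL [y0 Y1]; have [mX mY _] := indXY.
suff cS : concentrated (fun w => X w + Y w) (k + 1).
  split; first exact: concentrated_of_sum cS.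
  apply: (concentrated_of_sum (independent_rvC indXY)).
  by have -> : (fun w => Y w + X w) = (fun w => X w + Y w)
    by apply/funext => w; rewrite addrC.
apply: (@concentrated_of_congruent _ _ _ (y0 - alpha * y0) _ indL _ Y1).
  exact: measurable_event_ball.
move=> w /= Yw.
have -> : X w + Y w - (X w + alpha * Y w) - (y0 - alpha * y0)
  = - ((alpha - 1) * (Y w - y0)) by ring.
by apply: zballN; rewrite addrC; exact: zballM.
Qed.

End Concentration.

(** * Masses of cosets *)

Section Reduction.
Variables (p : nat) (pr_p : prime p) (N : nat).
Hypothesis N_gt0 : (0 < N)%N.
Local Notation Qp := (padic pr_p).
Local Notation Zp := (padic_int pr_p).
Local Notation iota := (@padic_of_int p pr_p).
Local Notation G := 'Z_(p ^ N).

Let q_gt1 : (1 < p ^ N)%N := expn_prime_gt1 pr_p N_gt0.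

Definition reduce (z : Zp) : G := (z N)%:R.

Lemma reduce_val z : reduce z = z N :> nat.
Proof. by rewrite /reduce val_Zp_nat// residue_mod. Qed.

Lemma natr_Zp_mod n : (n %% p ^ N)%:R = n%:R :> G.
Proof. by apply: val_inj; rewrite /= !val_Zp_nat// modn_mod. Qed.

Lemma reduce_nat n : reduce n%:R = n%:R.
Proof. by rewrite /reduce residue_nat natr_Zp_mod. Qed.

Lemma reduceK (i : G) : reduce (i : nat)%:R = i.
Proof. by rewrite reduce_nat natr_Zp. Qed.

Lemma reduceD z t : reduce (z + t) = reduce z + reduce t.
Proof. by rewrite /reduce residueD natr_Zp_mod natrD. Qed.

Lemma reduceM z t : reduce (z * t) = reduce z * reduce t.
Proof. by rewrite /reduce residueM natr_Zp_mod natrM. Qed.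

Lemma reduceB z t : reduce (z - t) = reduce z - reduce t.
Proof. by apply/eqP; rewrite eq_sym subr_eq -reduceD subrK. Qed.

Lemma reduce1 : reduce 1 = 1. Proof. exact: (reduce_nat 1). Qed.

Lemma reduce_unit z : z \is a GRing.unit -> reduce z \is a GRing.unit.
Proof.
by move=> uz; apply/unitrP; exists (reduce z^-1);
  rewrite -!reduceM mulVr// mulrV// reduce1.
Qed.

(** The cells number, by Z/p^N, the cosets of p^(k+N) Z_p inside c + p^k Z_p. *)
Definition cell (c : Qp) k (i : G) : set Qp :=
  coset_ball (c + p%:R ^ k * (i : nat)%:R) (k + N%:Z).

Lemma cell_reduce c k z :
  cell c k (reduce z) = coset_ball (c + p%:R ^ k * iota z) (k + N%:Z).
Proof.
apply: coset_ball_eq; rewrite /coset_ball /= opprD addrACA subrr add0r -mulrBr.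
rewrite -(rmorph_nat iota (reduce z)) -rmorphB; apply/zball_residueM/eqP.
by rewrite residue_subr residue_nat reduce_val residue_mod.
Qed.

Lemma cellE c k (i : G) :
  cell c k i = coset_ball (c + p%:R ^ k * iota (i : nat)%:R) (k + N%:Z).
Proof. by rewrite /cell rmorph_nat. Qed.

Lemma cell_cover c k x : coset_ball c k x -> exists i, cell c k i x.
Proof.
move=> [z xE]; exists (reduce z); rewrite cell_reduce /coset_ball /=.
by rewrite opprD addrA xE subrr; exact: zball0.
Qed.

(** The linear map (x, y) -> (x + y, x + a0 y) has determinant a0 - 1, a unit, so it is invertible
    modulo p^(k+N) Z_p. *)
Lemma cell_forms c e k (a0 : Zp) x y (i j : G) : 1 - a0 \is a GRing.unit ->
  (cell c k i x /\ cell e k j y) <->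
  (cell (c + e) k (i + j) (x + y) /\
   cell (c + iota a0 * e) k (i + reduce a0 * j) (x + iota a0 * y)).
Proof.
move=> ua; set zi : Zp := (i : nat)%:R; set zj : Zp := (j : nat)%:R.
have -> : i + j = reduce (zi + zj) by rewrite reduceD !reduceK.
have -> : i + reduce a0 * j = reduce (zi + a0 * zj) by rewrite reduceD reduceM !reduceK.
rewrite !cell_reduce !cellE /coset_ball /= -/zi -/zj.
set u := x - _; set v := y - _.
have -> : x + y - (c + e + p%:R ^ k * iota (zi + zj)) = u + v.
  by rewrite /u /v rmorphD; move: (p%:R ^ k) => pk; ring.
have -> : x + iota a0 * y - (c + iota a0 * e + p%:R ^ k * iota (zi + a0 * zj))
    = u + iota a0 * v.
  by rewrite /u /v rmorphD rmorphM; move: (p%:R ^ k) => pk; ring.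
split=> [[hu hv]|[h1 h2]]; first by split; apply: zballD => //; exact: zball_intM.
suff hv : zball (k + N%:Z) v by split=> //; have := zballB h1 hv; rewrite addrK.
have := zballB h1 h2.
have -> : u + v - (u + iota a0 * v) = p%:R ^ 0 * iota (1 - a0) * v.
  by rewrite rmorphB rmorph1 expr0z; ring.
by rewrite -{1}[k + N%:Z]add0r => /(zballMr _ _ _ ua).
Qed.

End Reduction.

(** * Random variables seen through their cell masses *)

Section UniformMasses.
Variables (R : realType) (p : nat) (pr_p : prime p).
Variables (d : measure_display) (T : measurableType d) (P : probability T R).
Local Notation Qp := (padic pr_p).
Local Notation Zp := (padic_int pr_p).
Local Notation iota := (@padic_of_int p pr_p).
Local Notation pr := (pr P).
Implicit Types (X Y L : T -> Qp) (k n : int).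

Definition mass X c k N (i : 'Z_(p ^ N)) : R := pr (X @^-1` cell c k i).

Lemma mass_ge0 X c k N (i : 'Z_(p ^ N)) : 0 <= mass X c k i.
Proof. exact: pr_ge0. Qed.

Lemma measurable_cell X c k N (i : 'Z_(p ^ N)) :
  measurable_fun setT X -> measurable (X @^-1` cell c k i).
Proof. exact: measurable_event_ball. Qed.

Lemma mass_null X c k N (S : pred 'Z_(p ^ N)) (A : set T) :
  measurable_fun setT X -> measurable A ->
  (forall i, S i -> mass X c k i = 0) ->
  (forall w, A w -> exists2 i, S i & cell c k i (X w)) -> pr A = 0.
Proof.
move=> mX mA S0 AS.
apply: (pr0_cover (B := fun j : nat => if S j%:R
  then X @^-1` cell c k (j%:R : 'Z_(p ^ N)) else set0)) => //.
- by move=> j; case: ifP => // _; exact: measurable_cell.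
- by move=> j; case: ifP => [/S0//|_]; exact: pr_set0.
- by move=> w /AS[i Si Xi]; exists (i : nat) => //; rewrite natr_Zp Si.
Qed.

Lemma mass_neq0 X c k N : (0 < N)%N -> measurable_fun setT X ->
  pr (X @^-1` coset_ball c k) = 1 -> exists i : 'Z_(p ^ N), mass X c k i != 0.
Proof.
move=> N0 mX X1; apply: contrapT => /forallNP h.
have : pr (X @^-1` coset_ball c k) = 0.
  apply: (@mass_null X c k N xpredT) => //; first exact: measurable_event_ball.
    by move=> i _; have /negP/negPn/eqP := h i.
  by move=> w /(cell_cover N0)[i Xi]; exists i.
by rewrite X1 => /eqP; rewrite oner_eq0.
Qed.

(** If all cells j with j - i a unit were null, X would almost surely fall in cells with j - i
    divisible by p, whose union lies in one coset of p^(k+1) Z_p. *)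
Lemma spread_mass X c k N : (0 < N)%N -> measurable_fun setT X ->
  pr (X @^-1` coset_ball c k) = 1 -> ~ concentrated P X (k + 1) ->
  spread (@mass X c k N).
Proof.
move=> N0 mX X1 nX i; apply: contrapT => h; apply: nX.
exists (c + p%:R ^ k * (i : nat)%:R).
have mi := measurable_event_ball (c + p%:R ^ k * (i : nat)%:R) (k + 1) mX.
have mc := measurable_event_ball c k mX.
suff e : pr (X @^-1` coset_ball c k `&`
    ~` (X @^-1` coset_ball (c + p%:R ^ k * (i : nat)%:R) (k + 1))) = 0.
  have := prI1 mc (measurableC mi) X1; rewrite e prC// => /esym/eqP.
  by rewrite subr_eq0 => /eqP.
apply: (@mass_null X c k N (fun j => j - i \is a GRing.unit)) => //.
- by apply: measurableI => //; exact: measurableC.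
- move=> j uj; apply/eqP; apply/negP => /negP nz; apply: h; exists j => //.
move=> w [/(cell_cover N0)[j Xj] nXi]; exists j => //.
apply/negP => /negP /(Zp_nonunit pr_p N0)[t jE]; apply: nXi.
have {}jE : j = reduce N ((i : nat)%:R + p%:R * (t : nat)%:R : Zp).
  by rewrite reduceD// reduceM// !reduceK// reduce_nat// -jE addrC subrK.
move: Xj; rewrite jE cell_reduce// => Xj.
apply: (@coset_ball_trans _ _ _
  (c + p%:R ^ k * iota ((i : nat)%:R + p%:R * (t : nat)%:R))).
  rewrite /coset_ball /= rmorphD rmorphM !rmorph_nat.
  rewrite [X in zball _ X](_ : _ = p%:R ^ k * (p%:R ^ 1 * iota (t : nat)%:R)).
    by apply/zball_expM; exists (t : nat)%:R.
  by rewrite rmorph_nat expr1z; move: (p%:R ^ k) => pk; ring.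
by apply: coset_ball_le Xj; lia.
Qed.

Variables (X Y : T -> Qp) (a0 : Zp) (k : int) (x0 y0 : Qp).
Variable mu : probability Qp R.
Hypotheses (indXY : independent_rv P X Y)
  (indL : independent_rv P (fun w => X w + Y w) (fun w => X w + iota a0 * Y w)).
Hypothesis ua : 1 - a0 \is a GRing.unit.
Hypothesis X1 : pr (X @^-1` coset_ball x0 k) = 1.
Hypothesis Y1 : pr (Y @^-1` coset_ball y0 k) = 1.

(** Supplies the factorization assumed on finite rings: by [cell_forms] both sides are the
    probability of the same event. *)
Lemma mass_independent N (i j : 'Z_(p ^ N)) : (0 < N)%N ->
  mass X x0 k i * mass Y y0 k j =
  mass (fun w => X w + Y w) (x0 + y0) k (i + j) *
  mass (fun w => X w + iota a0 * Y w) (x0 + iota a0 * y0) k (i + reduce N a0 * j).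
Proof.
move=> N0; rewrite /mass.
rewrite -(independent_pr indXY); [|exact: measurable_coset_ball..].
rewrite -(independent_pr indL); [|exact: measurable_coset_ball..].
by congr pr; apply/seteqP; split=> w /(cell_forms N0 x0 y0 k _ _ i j ua).
Qed.

End UniformMasses.

Section UniformIdempotent.
Variables (R : realType) (p : nat) (pr_p : prime p).
Variables (d : measure_display) (T : measurableType d) (P : probability T R).
Local Notation Qp := (padic pr_p).
Local Notation Zp := (padic_int pr_p).
Local Notation iota := (@padic_of_int p pr_p).
Local Notation pr := (pr P).
Variables (X : T -> Qp) (mu : probability Qp R).
Hypotheses (mX : measurable_fun setT X)
  (muE : forall A, measurable A -> mu A = P (X @^-1` A)).

Lemma idempotent_of_mass_const x0 k : pr (X @^-1` coset_ball x0 k) = 1 ->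
  (forall N : nat, (0 < N)%N ->
     forall i j : 'Z_(p ^ N), mass P X x0 k i = mass P X x0 k j) ->
  idempotent_distribution mu.
Proof.
move=> X1 cst; apply: (@idempotent_of_uniform _ _ _ _ x0 k).
  rewrite muE; last exact: measurable_coset_ball.
  by apply/pr_eq1 => //; exact: measurable_event_ball.
move=> [|N] u v ku kv.
  (* Level 0 is treated apart, because ['Z_1] is not the trivial ring; both balls are then the whole
     coset. *)
  rewrite addr0; congr (mu _); rewrite !(@coset_ball_eq _ _ _ x0)//;
    by rewrite /coset_ball /= addrAC subrr add0r.
have [zu ->] := ku; have [zv ->] := kv.
rewrite -!cell_reduce// !muE; [|exact: measurable_coset_ball..].
by rewrite !prE; [congr _%:E; exact: cst|exact: measurable_cell..].
Qed.

(** A charged cell i must meet x0 + p^(k+1) Z_p, so i is a multiple of p and i + p G = p G. Level N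
    inside this coset is level N + 1 inside x0 + p^k Z_p. *)
Lemma idempotent_of_mass_prime x0 k : pr (X @^-1` coset_ball x0 (k + 1)) = 1 ->
  (forall N : nat, (0 < N)%N -> exists2 i : 'Z_(p ^ N), mass P X x0 k i != 0 &
     forall t, mass P X x0 k (i + p%:R * t) = mass P X x0 k i) ->
  idempotent_distribution mu.
Proof.
move=> X1 cst; apply: (@idempotent_of_uniform _ _ _ _ x0 (k + 1)).
  rewrite muE; last exact: measurable_coset_ball.
  by apply/pr_eq1 => //; exact: measurable_event_ball.
move=> N u v ku kv; have [i i0 iP] := cst N.+1 isT.
have [z iE] : exists z : Zp, i = reduce N.+1 (p%:R * z).
  have [w [Xw]] :
      exists w, (X @^-1` coset_ball x0 (k + 1)) w /\ (X @^-1` cell x0 k i) w.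
    apply: contrapT => /forallNP h; move/eqP: i0; apply.
    have mB := measurable_event_ball x0 (k + 1) mX.
    apply: (@pr_null _ _ _ P _ (~` (X @^-1` coset_ball x0 (k + 1)))).
    - exact: measurable_cell.
    - exact: measurableC.
    - by move=> w iw Xw; exact: (h w).
    - by rewrite prC// X1 subrr.
  rewrite /= cellE => iw.
  have le1 : k + 1 <= k + N.+1%:Z by lia.
  have := coset_ball_trans Xw (coset_ball_sym (coset_ball_le le1 iw)).
  rewrite /coset_ball /= addrAC subrr add0r => /(zball_residueM k 1).
  by move=> /padic_div_pow[z iz]; exists z; rewrite -[LHS]reduceK// iz.
have massE s : mass P X x0 k (reduce N.+1 (p%:R * s : Zp)) = mass P X x0 k i.
  rewrite -(iP (reduce N.+1 (s - z))); congr mass.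
  rewrite iE !reduceM// reduceB// reduce_nat//; ring.
have uE u' : zball (k + 1) u' ->
    mu (coset_ball (x0 + u') (k + 1 + N%:Z)) = (mass P X x0 k i)%:E.
  move=> [s ->].
  have -> : coset_ball (x0 + p%:R ^ (k + 1) * iota s) (k + 1 + N%:Z) =
     cell x0 k (reduce N.+1 (p%:R * s)).
    rewrite cell_reduce// rmorphM rmorph_nat expfzDr ?padic_prime_neq0// expr1z mulrA.
    by congr coset_ball; lia.
  rewrite muE; last exact: measurable_coset_ball.
  by rewrite prE -?(massE s)//; exact: measurable_cell.
by rewrite !uE.
Qed.

End UniformIdempotent.

(** * Independent forms with a unit or p times a unit as coefficient *)

Section IndependentFormsIdempotent.
Variables (R : realType) (p : nat) (pr_p : prime p).
Variables (d : measure_display) (T : measurableType d) (P : probability T R).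
Local Notation Qp := (padic pr_p).
Local Notation Zp := (padic_int pr_p).
Local Notation iota := (@padic_of_int p pr_p).
Local Notation concentrated := (concentrated P).
Variables (X Y : T -> Qp) (mu nu : probability Qp R) (c : Zp).
Hypotheses (muE : forall A, measurable A -> mu A = P (X @^-1` A))
  (nuE : forall A, measurable A -> nu A = P (Y @^-1` A)).
Hypotheses (indXY : independent_rv P X Y) (uc : c \is a GRing.unit).

Let mX : measurable_fun setT X. Proof. by case: indXY. Qed.
Let mY : measurable_fun setT Y. Proof. by case: indXY. Qed.

Lemma degenerate_of_bounded (alpha : Qp) (m : int) : zball 1 (alpha - 1) ->
  independent_rv P (fun w => X w + Y w) (fun w => X w + alpha * Y w) ->
  concentrated X m -> concentrated Y m ->
  degenerate_distribution mu /\ degenerate_distribution nu.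
Proof.
move=> al1 indL Xm Ym.
have D (n : nat) : concentrated X (m + n%:Z) /\ concentrated Y (m + n%:Z).
  elim: n => [|n [_ IHn]]; first by rewrite addr0.
  by have := concentrated_step al1 indXY indL IHn; rewrite -addrA -PoszD addn1.
split.
  apply: (concentrated_degenerate mX muE) => k.
  by apply: (concentrated_le mX _ (D `|k - m|%N).1); lia.
apply: (concentrated_degenerate mY nuE) => k.
by apply: (concentrated_le mY _ (D `|k - m|%N).2); lia.
Qed.

(** Refining from m, either joint concentration never fails and both laws are degenerate, or k is
    the level just before a failure. *)
Lemma concentration_level (m : int) : concentrated X m -> concentrated Y m ->
  (degenerate_distribution mu /\ degenerate_distribution nu) \/
  exists k, [/\ concentrated X k, concentrated Y k &
    ~ concentrated X (k + 1) \/ ~ concentrated Y (k + 1)].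
Proof.
move=> Xm Ym.
have [D|/existsNP[n nD]] := pselect (forall n : nat,
    concentrated X (m + n%:Z) /\ concentrated Y (m + n%:Z)).
  left; split.
    apply: (concentrated_degenerate mX muE) => k.
    by apply: (concentrated_le mX _ (D `|k - m|%N).1); lia.
  apply: (concentrated_degenerate mY nuE) => k.
  by apply: (concentrated_le mY _ (D `|k - m|%N).2); lia.
right; elim: n nD => [|n IHn] nD; first by case: nD; rewrite addr0.
have [[Xn Yn]|//] := pselect (concentrated X (m + n%:Z) /\ concentrated Y (m + n%:Z)).
exists (m + n%:Z); split=> //; apply/not_andP.
by rewrite -addrA -PoszD addn1.
Qed.

Lemma independent_forms_unit :
  independent_rv P (fun w => X w + Y w) (fun w => X w + iota c * Y w) ->
  (idempotent_distribution mu /\ idempotent_distribution nu) /\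
  (padic_digit c 0 = 1%N ->
   degenerate_distribution mu /\ degenerate_distribution nu).
Proof.
move=> indL.
have alP n (x : Qp) : zball (n + 0%N%:Z) (iota c * x) <-> zball n x.
  by have := zballMr 0 n x uc; rewrite expr0z mul1r add0r addr0.
have [m [Xm1 Ym1]] := bounded_of_independent_forms alP indXY indL.
have z0 : coset_ball (0 : Qp) m = zball m.
  by apply/funext => x; rewrite /coset_ball /= subr0.
have Xm : concentrated X m by exists 0; rewrite z0.
have Ym : concentrated Y m by exists 0; rewrite z0.
have deg : (1 - c) 1%N = 0%N -> degenerate_distribution mu /\ degenerate_distribution nu.
  move=> c1; apply: (degenerate_of_bounded _ indL Xm Ym).
  by rewrite -opprB; apply: zballN; rewrite -(rmorph1 iota) -rmorphB; exact/zball_residue.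
split; last first.
  rewrite /padic_digit expn0 divn1 => c1; apply: deg; apply/eqP.
  by rewrite residue_subr residue1 c1 expn1 modn_small// prime_gt1.
(* Either c = 1 mod p, where the laws are degenerate, or 1 - c is a unit and the finite-ring lemmas
   apply. *)
have [/deg[degX degY]|uc1] := pselect ((1 - c) 1%N = 0%N).
  by split; exact: idempotent_of_degenerate.
have {}uc1 : 1 - c \is a GRing.unit by exact/padic_unitP.
have [[degX degY]|[k [[x0 X1] [y0 Y1] nXY]]] := concentration_level Xm Ym.
  by split; exact: idempotent_of_degenerate.
have cst (N : nat) (i j : 'Z_(p ^ N)) : (0 < N)%N ->
    mass P X x0 k i = mass P X x0 k j /\ mass P Y y0 k i = mass P Y y0 k j.
  move=> N0.
  have ur : reduce N c \is a GRing.unit by exact: reduce_unit.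
  have ur1 : 1 - reduce N c \is a GRing.unit.
    by rewrite -(reduce1 pr_p N0) -reduceB//; exact: reduce_unit.
  have abE := fun i j => mass_independent k x0 y0 indXY indL uc1 i j N0.
  have mX0 := mass_neq0 N0 mX X1; have mY0 := mass_neq0 N0 mY Y1.
  case: nXY => [nX|nY].
    exact: (masses_const_l ur1 (mass_ge0 P X x0 k (N:=N)) (mass_ge0 P Y y0 k (N:=N))
      mX0 mY0 abE ur (spread_mass N0 mX X1 nX) i j).
  exact: (masses_const_r ur1 (mass_ge0 P X x0 k (N:=N)) (mass_ge0 P Y y0 k (N:=N))
      mX0 mY0 abE ur (spread_mass N0 mY Y1 nY) i j).
split.
  by apply: (idempotent_of_mass_const mX muE X1) => N N0 i j; have [] := cst N i j N0.
by apply: (idempotent_of_mass_const mY nuE Y1) => N N0 i j; have [] := cst N i j N0.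
Qed.

(** If X charges several cosets of p^(k+1) Z_p, then Y is uniform on its coset of p^k Z_p. Otherwise
    X stays in one such coset while Y does not, and X is uniform on that coset. *)
Lemma independent_forms_prime :
  independent_rv P (fun w => X w + Y w) (fun w => X w + iota (p%:R * c) * Y w) ->
  idempotent_distribution mu \/ idempotent_distribution nu.
Proof.
move=> indL.
have alP n (x : Qp) : zball (n + 1%N%:Z) (iota (p%:R * c) * x) <-> zball n x.
  by have := zballMr 1 n x uc; rewrite expr1z rmorphM rmorph_nat addrC.
have [m [Xm1 Ym1]] := bounded_of_independent_forms alP indXY indL.
have z0 : coset_ball (0 : Qp) m = zball m.
  by apply/funext => x; rewrite /coset_ball /= subr0.
have Xm : concentrated X m by exists 0; rewrite z0.
have Ym : concentrated Y m by exists 0; rewrite z0.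
have uc1 : 1 - p%:R * c \is a GRing.unit.
  apply/padic_unitP/eqP; rewrite residue_subr residue_eq0M.
    by rewrite residue1 expn1 modn_small// prime_gt1.
  by rewrite residue_nat expn1 modnn.
have [[degX degY]|[k [[x0 X1] [y0 Y1] nXY]]] := concentration_level Xm Ym.
  by left; exact: idempotent_of_degenerate.
have ur N : (0 < N)%N -> reduce N c \is a GRing.unit by move=> ?; exact: reduce_unit.
have ur1 N : (0 < N)%N -> 1 - reduce N (p%:R * c) \is a GRing.unit.
  by move=> N0; rewrite -(reduce1 pr_p N0) -reduceB//; exact: reduce_unit.
have aE N : (0 < N)%N -> reduce N (p%:R * c) = p%:R * reduce N c.
  by move=> N0; rewrite reduceM// reduce_nat.
have [[x1 X1']|nX] := pselect (concentrated X (k + 1)); last first.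
  right; apply: (idempotent_of_mass_const mY nuE Y1) => N N0.
  exact: (masses_const_of_spread pr_p N0 (ur1 N N0) (mass_ge0 P X x0 k (N:=N))
    (mass_ge0 P Y y0 k (N:=N)) (mass_neq0 N0 mX X1) (mass_neq0 N0 mY Y1)
    (fun i j => mass_independent k x0 y0 indXY indL uc1 i j N0) (aE N N0)
    (spread_mass N0 mX X1 nX)).
have nY : ~ concentrated Y (k + 1) by case: nXY => // nX _; apply: nX; exists x1.
left.
(* The cells of X are recentred at x1, so that the coset of p^(k+1) Z_p carrying X corresponds to
   the cells of p G. *)
have X1k : pr P (X @^-1` coset_ball x1 k) = 1.
  apply: pr_full X1'; [exact: measurable_event_ball..|].
  by move=> w; apply: coset_ball_le; lia.
apply: (idempotent_of_mass_prime mX muE X1') => N N0.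
exact: (masses_const_prime_coset pr_p N0 (ur1 N N0) (mass_ge0 P X x1 k (N:=N))
    (mass_ge0 P Y y0 k (N:=N)) (mass_neq0 N0 mX X1k) (mass_neq0 N0 mY Y1)
    (fun i j => mass_independent k x1 y0 indXY indL uc1 i j N0) (aE N N0) (ur N N0)
    (spread_mass N0 mY Y1 nY)).
Qed.

End IndependentFormsIdempotent.

(** Scaling the second form by alpha^-1 preserves independence and exchanges the two variables; this
    passes from k to - k. *)
Lemma independent_forms_inv (R : realType) (p : nat) (pr_p : prime p)
    (d : measure_display) (T : measurableType d) (P : probability T R)
    (X Y : T -> padic pr_p) (alpha : padic pr_p) : alpha != 0 ->
  independent_rv P (fun w => X w + Y w) (fun w => X w + alpha * Y w) ->
  independent_rv P (fun w => Y w + X w) (fun w => Y w + alpha^-1 * X w).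
Proof.
move=> al0 [mL1 mL2 L12].
have E : (fun w => Y w + alpha^-1 * X w) =
    affine_map alpha^-1 0 \o (fun w => X w + alpha * Y w).
  by apply/funext => w; rewrite /= /affine_map addr0 mulrDr mulKf// addrC.
have S : (fun w => Y w + X w) = (fun w => X w + Y w).
  by apply/funext => w; rewrite addrC.
have mA := @measurable_affine _ pr_p alpha^-1 0.
rewrite E S; split=> //; first exact: measurableT_comp.
move=> A B mA' mB; rewrite comp_preimage L12//.
by rewrite -[X in measurable X]setTI; exact: mA.
Qed.

(** * Haar measure and the counterexample *)

Section DigitReversal.
Variable p : nat.
Hypothesis p_gt0 : (0 < p)%N.

Fixpoint digit_rev n M : nat :=
  if n is n'.+1 then (digit_rev n' (M %/ p) + (M %% p) * p ^ n')%N else 0%N.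

(** Reversal is an involution on [0, p^n), so this is again reversal there; peeling off the top
    digit instead of the bottom one makes both cancellations direct inductions. *)
Fixpoint digit_rev_inv n j : nat :=
  if n is n'.+1 then (digit_rev_inv n' (j %% p ^ n') * p + j %/ p ^ n')%N else 0%N.

Lemma digit_rev_lt n M : (digit_rev n M < p ^ n)%N.
Proof.
elim: n M => [|n IHn] M //=; have := IHn (M %/ p)%N; have := ltn_pmod M p_gt0.
move: (M %% p)%N => r rp lt; rewrite expnS.
by rewrite (leq_trans (_ : _ < r.+1 * p ^ n)%N) ?leq_mul2r ?rp ?orbT// mulSn ltn_add2r.
Qed.

Lemma digit_revK n M : (M < p ^ n)%N -> digit_rev_inv n (digit_rev n M) = M.
Proof.
elim: n M => [|n IHn] M /=; first by rewrite expn0 ltnS leqn0 => /eqP.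
move=> lt_M; have pn0 : (0 < p ^ n)%N by rewrite expn_gt0 p_gt0.
rewrite [(digit_rev _ _ + _)%N]addnC modnMDl modn_small ?digit_rev_lt// IHn; last first.
  by rewrite ltn_divLR// -expnSr.
by rewrite divnMDl// (divn_small (digit_rev_lt _ _)) addn0 -divn_eq.
Qed.

Lemma digit_rev_inv_lt n j : (j < p ^ n)%N -> (digit_rev_inv n j < p ^ n)%N.
Proof.
elim: n j => [|n IHn] j //= lt_j; have pn0 : (0 < p ^ n)%N by rewrite expn_gt0 p_gt0.
have := IHn (j %% p ^ n)%N (ltn_pmod _ pn0).
have : (j %/ p ^ n < p)%N by rewrite ltn_divLR// -expnS.
move: (digit_rev_inv _ _) (j %/ _)%N => M r rp lt; rewrite expnSr.
by rewrite (leq_trans (_ : _ < M.+1 * p)%N) ?leq_mul2r ?lt ?orbT// mulSn addnC ltn_add2r.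
Qed.

Lemma digit_rev_invK n j : (j < p ^ n)%N -> digit_rev n (digit_rev_inv n j) = j.
Proof.
elim: n j => [|n IHn] j /=; first by rewrite expn0 ltnS leqn0 => /eqP.
move=> lt_j; have pn0 : (0 < p ^ n)%N by rewrite expn_gt0 p_gt0.
have jp : (j %/ p ^ n < p)%N by rewrite ltn_divLR// -expnS.
rewrite divnMDl// (divn_small jp) addn0 IHn ?ltn_pmod//.
by rewrite modnMDl (modn_small jp) addnC -divn_eq.
Qed.

End DigitReversal.

(** * Haar measure on Z_p from uniform digits *)

Section Haar.
Variables (R : realType) (p : nat) (pr_p : prime p).
Local Notation Qp := (padic pr_p).
Local Notation Zp := (padic_int pr_p).
Local Notation iota := (@padic_of_int p pr_p).

Let p_gt0 : (0 < p)%N := prime_gt0 pr_p.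

(** Division by p drops the last base-p digit, which relates the truncations of w to n + 1 and to n
    digits. *)
Lemma truncn_divn (x : R) : (Num.truncn (p%:R * x) %/ p)%N = Num.truncn x.
Proof.
have [x0|x0] := lerP 0 x; last first.
  by rewrite !truncn_floor !leNgt x0 pmulr_rlt0 ?ltr0n// x0 div0n.
apply/esym/truncn_def.
have /truncn_itv : 0 <= p%:R * x by rewrite mulr_ge0.
move: (Num.truncn _) => m /andP[m1 m2].
have p0 : 0 < p%:R :> R by rewrite ltr0n.
apply/andP; split.
  rewrite -(ler_pM2l p0) -natrM (le_trans _ m1)//.
  by rewrite ler_nat mulnC leq_trunc_div.
rewrite -(ltr_pM2l p0) -natrM (lt_le_trans m2)//.
by rewrite ler_nat mulnC ltn_ceil.
Qed.

(* The base-p digits of a uniform point of [0, 1], read in reverse order as those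
   of a p-adic integer, give Haar measure: cosets of p^n Z_p correspond to the
   intervals of length p^-n. *)
Definition digit_expansion (w : R) n :=
  digit_rev p n (Num.truncn (p%:R ^+ n * w)).

(** The new digit is the last one of the truncation, and reversal makes it the coefficient of
    p^n. *)
Lemma digit_expansion_coherent w n :
  (digit_expansion w n.+1 = digit_expansion w n %[mod p ^ n])%N.
Proof.
rewrite /digit_expansion /= exprS -mulrA truncn_divn.
by rewrite addnC modnMDl.
Qed.

Definition random_padic_int w : Zp := padic_of pr_p (digit_expansion_coherent w).

Lemma random_padic_intE w n : random_padic_int w n = digit_expansion w n.
Proof. by rewrite /= modn_small// digit_rev_lt. Qed.

Definition random_padic (w : measurableTypeR R) : Qp := iota (random_padic_int w).

Lemma measurable_truncn (a : R) (m : nat) : 0 < a ->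
  measurable [set w : R | Num.truncn (a * w) = m].
Proof.
move=> a0.
have mle j : measurable [set w : R | (Num.truncn (a * w) <= j)%N].
  rewrite (_ : mkset _ = `]-oo, j.+1%:R / a[%classic); first exact: measurable_itv.
  by apply/funext => w /=; rewrite in_itv/= truncn_le_nat ltr_pdivlMr// mulrC.
case: m => [|m].
  rewrite (_ : mkset _ = [set w : R | (Num.truncn (a * w) <= 0)%N])//.
  by apply/seteqP; split=> w /=; rewrite leqn0 => /eqP.
rewrite (_ : mkset _ = [set w : R | (Num.truncn (a * w) <= m.+1)%N]
   `\` [set w : R | (Num.truncn (a * w) <= m)%N]); first exact: measurableD.
apply/seteqP; split=> w /=; first by move=> ->; rewrite ltnn.
by move=> [h1 /negP]; rewrite -ltnNge => h2; apply/eqP; rewrite eqn_leq h1.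
Qed.

(** A union, because [digit_rev p n] sees only the n lowest digits of m while w ranges over the
    whole line. *)
Lemma random_padic_coset (z : Zp) n :
  random_padic @^-1` coset_ball (iota z) n%:Z
  = \bigcup_(m in [set m | digit_rev p n m = z n])
      [set w : R | Num.truncn (p%:R ^+ n * w) = m].
Proof.
have E w : coset_ball (iota z) n%:Z (random_padic w) <-> digit_expansion w n = z n.
  rewrite /coset_ball /random_padic /= -rmorphB.
  apply: (iff_trans (zball_residue _ _)); rewrite -random_padic_intE.
  split=> [/eqP|h]; first by rewrite residue_subr => /eqP.
  by apply/eqP; rewrite residue_subr h.
apply/seteqP; split=> w; first by move/E => h; exists (Num.truncn (p%:R ^+ n * w)).
by move=> [m /= mz wm]; apply/E; rewrite /digit_expansion wm.
Qed.

Lemma measurable_random_padic : measurable_fun setT random_padic.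
Proof.
apply: measurable_fun_continuous => x n.
have [[z xz]|nx] := pselect (zball 0 x); last first.
  rewrite (_ : _ @^-1` _ = set0)//.
  apply/seteqP; split=> // w /=; rewrite /coset_ball /= => h; apply: nx.
  have := zballB (zball_int (random_padic_int w)) (zball_le (_ : 0 <= n%:Z) h).
  by rewrite opprB addrC subrK; apply.
move: xz; rewrite expr0z mul1r => ->; rewrite random_padic_coset.
rewrite bigcup_mkcond; apply: bigcupT_measurable => m.
case: ifP => // _; apply: measurable_truncn.
by rewrite exprn_gt0// ltr0n.
Qed.

HB.instance Definition _ := isMeasurableFun.Build _ _
  (measurableTypeR R) Qp random_padic measurable_random_padic.

Let U : probability (measurableTypeR R) R := uniform_prob (@ltr01 R).

Definition haar : probability Qp R := distribution U random_padic.

Let UE (A : set R) : measurable A -> U A = lebesgue_measure (A `&` `[0, 1]).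
Proof.
move=> mA; rewrite -[A in LHS]setIT -integral_indic//.
rewrite integral_uniform//; last by apply/measurable_EFinP; exact: measurable_indic.
by rewrite subr0 invr1 mul1e integral_indic.
Qed.

(** For w in [0, 1) a single truncation M reverses to [z n], so the event is the interval [I] of
    length p^-n. *)
Lemma haar_coset (z : Zp) n : haar (coset_ball (iota z) n%:Z) = ((p%:R ^+ n)^-1)%:E.
Proof.
rewrite /haar /= /pushforward /= random_padic_coset.
set B := \bigcup_(_ in _) _.
have pn0 : 0 < p%:R ^+ n :> R by rewrite exprn_gt0// ltr0n.
have mB : measurable B.
  rewrite /B bigcup_mkcond; apply: bigcupT_measurable => m.
  by case: ifP => // _; exact: measurable_truncn.
rewrite UE//.
pose M := digit_rev_inv p n (z n).
have M_lt : (M < p ^ n)%N by apply: digit_rev_inv_lt => //; exact: residue_lt.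
have revM : digit_rev p n M = z n by apply: digit_rev_invK => //; exact: residue_lt.
pose I := `[M%:R / p%:R ^+ n, M.+1%:R / p%:R ^+ n[%classic : set R.
have II : lebesgue_measure I = ((p%:R ^+ n)^-1)%:E.
  rewrite /I lebesgue_measure_itv /= lte_fin ltr_pM2r ?invr_gt0// ltr_nat ltnSn.
  by rewrite -EFinB -mulrBl -natrB ?leqnSn// subSnn mul1r.
apply/le_anti/andP; split.
  (* The endpoint w = 1 truncates to p^n, outside the range of n digits; it is absorbed as a null
     point. *)
  rewrite -II -[leRHS]adde0 -(lebesgue_measure_set1 (1 : R)).
  apply: (le_trans _ (measureU2 _ _ _)) => //; last exact: measurable_itv.
  apply: le_measure; rewrite ?inE.
  - by apply: measurableI => //; exact: measurable_itv.
  - by apply: measurableU => //; exact: measurable_itv.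
  move=> w [[m /= rm wm]]; rewrite in_itv /= => /andP[w0 w1].
  have [->|w1'] := eqVneq w 1; [by right|left].
  have {w1'}w1 : w < 1 by rewrite lt_neqAle w1' w1.
  have w0' : 0 <= p%:R ^+ n * w by rewrite mulr_ge0// ltW.
  have m_lt : (m < p ^ n)%N.
    by rewrite -wm truncn_lt_nat// natrX gtr_pMr.
  have mM : m = M by rewrite /M -rm digit_revK.
  rewrite /I /= in_itv /= ler_pdivrMr// ltr_pdivlMr// ![w * _]mulrC -mM -wm.
  exact: truncn_itv.
rewrite -II; apply: le_measure; rewrite ?inE.
- exact: measurable_itv.
- by apply: measurableI => //; exact: measurable_itv.
move=> w; rewrite /I /= in_itv /= => /andP[w1 w2]; split.
  exists M => //=; apply: truncn_def.
  by rewrite mulrC -ler_pdivrMr// w1 -ltr_pdivlMr.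
rewrite in_itv /= (le_trans _ w1)/= ?divr_ge0 ?ler0n// ?exprn_ge0//.
apply: (le_trans (ltW w2)); rewrite ler_pdivrMr// mul1r -natrX ler_nat.
exact: M_lt.
Qed.

Lemma haar_invariant x A : zball 0 x -> measurable A ->
  haar [set y | A (x + y)] = haar A.
Proof.
apply: (@invariant_of_uniform _ _ _ _ 0).
  by have := haar_coset 0 0; rewrite rmorph0 expr0 invr1.
move=> N u v [zu ->] [zv ->].
by rewrite !add0r expr0z !mul1r !haar_coset.
Qed.

End Haar.

(** * An obstruction to being idempotent *)

Section NonIdempotent.
Variables (R : realType) (p : nat) (pr_p : prime p).
Local Notation Qp := (padic pr_p).
Implicit Types (x y : Qp) (n : int) (mu : probability Qp R) (A K : set Qp).

Lemma padic_hausdorff : hausdorff_space Qp.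
Proof.
move=> x y xy; apply/subr0_eq/bigcap_zball => n.
have nb (z : Qp) : nbhs z (coset_ball z n%:Z).
  by apply: open_nbhs_nbhs; split;
    [exact: open_coset_ball|exact: coset_ball_center].
have [z [xz yz]] := xy _ _ (nb x) (nb y).
exact: coset_ball_trans yz (coset_ball_sym xz).
Qed.

Lemma measurable_compact K : compact K -> measurable K.
Proof.
move=> cK; rewrite -[K]setCK; apply: measurableC.
apply: sub_sigma_algebra; rewrite openC.
exact: compact_closed padic_hausdorff cK.
Qed.

(* Two cosets meeting the subgroup K are exchanged by a translation of K. *)
Lemma idempotent_coset_mass mu x y n : idempotent_distribution mu ->
  mu (coset_ball x n) != 0%E -> mu (coset_ball y n) != 0%E ->
  mu (coset_ball x n) = mu (coset_ball y n).
Proof.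
move=> [K [m [x0 [[cK _ subK] [mK1 minv] muE]]]].
have mK := measurable_compact cK.
have {}muE z : mu (coset_ball z n) = m (coset_ball (z - x0) n).
  rewrite muE; last exact: measurable_coset_ball.
  have mz := measurable_coset_ball (z - x0) n.
  rewrite /convolution -[coset_ball (z - x0) n]setIT -integral_indic//.
  apply: eq_integral => y' _; rewrite indicE diracE; congr ((_ : bool)%:R%:E).
  apply/idP/idP => /set_mem h; apply/mem_set; move: h; rewrite /coset_ball /=;
    by congr zball; ring.
have meets z : mu (coset_ball z n) != 0%E -> exists2 k, K k & coset_ball (z - x0) n k.
  move=> mz; apply: contrapT => nz; move/eqP: mz; apply.
  rewrite muE; apply/eqP; rewrite eq_le measure_ge0 andbT.
  have <- : m (~` K) = 0%E by rewrite probability_setC// mK1 subee.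
  apply: le_measure; rewrite ?inE.
  - exact: measurable_coset_ball.
  - exact: measurableC.
  - by move=> k zk Kk; apply: nz; exists k.
move=> /meets[k Kk xk] /meets[l Kl yl]; rewrite !muE.
rewrite -(minv (l - k) (coset_ball (y - x0) n) (subK _ _ Kl Kk)); last first.
  exact: measurable_coset_ball.
rewrite -(coset_ball_eq xk) -(coset_ball_eq yl); congr (m _).
by apply/funext => z; rewrite /coset_ball /=; congr zball; ring.
Qed.

End NonIdempotent.

Section Mixture.
Variables (R : realType) (d : measure_display) (T : measurableType d).
Variables (m1 m2 : probability T R).
Local Open Scope ereal_scope.

(** The weights 1/3 and 2/3 are nonzero and unequal, which [idempotent_coset_mass] forbids for two
    cosets of the same subgroup. *)
Definition mixture : set T -> \bar R :=
  measure_add (mscale ((3^-1)%:nng)%R m1) (mscale ((2 / 3)%:nng)%R m2).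

HB.instance Definition _ := Measure.on mixture.

Lemma mixtureE A : mixture A = (3^-1)%R%:E * m1 A + (2 / 3)%R%:E * m2 A.
Proof. by rewrite /mixture measure_addE. Qed.

Lemma mixture_setT : mixture setT = 1.
Proof.
rewrite mixtureE !probability_setT !mule1 -EFinD; congr _%:E.
by field.
Qed.

HB.instance Definition _ :=
  Measure_isProbability.Build _ _ R mixture mixture_setT.

Definition mixture_law : probability T R := mixture.

Lemma mixture_lawE A : mixture_law A = (3^-1)%R%:E * m1 A + (2 / 3)%R%:E * m2 A.
Proof. exact: mixtureE. Qed.

End Mixture.

(** * Independent forms from invariant laws *)

Section IndependentFormsExample.
Variables (R : realType) (p : nat) (pr_p : prime p).
Local Notation Qp := (padic pr_p).
Local Notation Zp := (padic_int pr_p).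
Local Notation iota := (@padic_of_int p pr_p).
Implicit Types (m : probability Qp R) (k : int) (A B : set Qp).

Definition invariant_under m k :=
  forall x A, zball k x -> measurable A -> m [set y | A (x + y)] = m A.

Definition supported_on m k := m (zball k) = 1%E.

Lemma measurable_affine_preimage (a b : Qp) A :
  measurable A -> measurable [set x | A (a * x + b)].
Proof. by move=> mA; rewrite -[X in measurable X]setTI; exact: measurable_affine. Qed.

Definition affine_law m (b : Qp) : probability Qp R :=
  distribution m (affine_map p%:R b).

Lemma affine_lawE m b A : affine_law m b A = m [set x | A (p%:R * x + b)].
Proof. by []. Qed.

Lemma affine_law_invariant m b k :
  invariant_under m k -> invariant_under (affine_law m b) (k + 1).
Proof.
move=> inv x A [z ->] mA; rewrite !affine_lawE.
rewrite -(inv (p%:R ^ k * iota z) [set x | A (p%:R * x + b)]).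
- congr (m _); apply/funext => y /=; congr A.
  rewrite expfzDr ?padic_prime_neq0// expr1z; move: (p%:R ^ k) => pk; ring.
- by exists z.
- exact: measurable_affine_preimage.
Qed.

Lemma affine_law_supported m b k l : l <= k + 1 -> zball l b ->
  supported_on m k -> supported_on (affine_law m b) l.
Proof.
move=> le_l lb mk; rewrite /supported_on affine_lawE.
have mzk : measurable (zball k : set Qp) by exact: measurable_zball.
have mzl : measurable (zball l : set Qp) by exact: measurable_zball.
have mS := measurable_affine_preimage p%:R b mzl.
apply/le_anti; rewrite probability_le1//= -mk; apply: le_measure; rewrite ?inE//.
move=> x kx /=; apply: zballD => //; apply: (zball_le le_l).
by rewrite addrC; apply: zballM => //; have := zball_exp pr_p 1; rewrite expr1z.
Qed.

Lemma mixture_invariant m1 m2 k : invariant_under m1 k -> invariant_under m2 k ->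
  invariant_under (mixture_law m1 m2) k.
Proof.
by move=> inv1 inv2 x A kx mA; rewrite !mixture_lawE (inv1 _ _ kx mA) (inv2 _ _ kx mA).
Qed.

Lemma mixture_supported m1 m2 k : supported_on m1 k -> supported_on m2 k ->
  supported_on (mixture_law m1 m2) k.
Proof.
rewrite /supported_on => s1 s2; rewrite mixture_lawE s1 s2 !mule1 -EFinD.
by congr _%:E; field.
Qed.

Lemma supported_ae m k : supported_on m k -> {ae m, forall x, zball k x}.
Proof.
move=> mk; have mzk : measurable (zball k : set Qp) by exact: measurable_zball.
exists (~` zball k); split=> //; first exact: measurableC.
by rewrite probability_setC// mk subee.
Qed.

Variables (m1 m2 : probability Qp R) (alpha : Qp) (k1 k2 j : int).
Hypotheses (s1 : supported_on m1 k1) (s2 : supported_on m2 k2).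
Hypotheses (i2 : invariant_under m2 k1) (i1 : invariant_under m1 j).
Hypothesis al1 : 1 - alpha != 0.
Hypothesis aj : forall y, zball k2 y -> zball j ((1 - alpha)^-1 * (alpha * y)).

Let P : probability (Qp * Qp)%type R := (m1 \x m2)%E.

Lemma measurable_form (a b : Qp) :
  measurable_fun setT (fun w : Qp * Qp => a * w.1 + b * w.2).
Proof.
apply: measurable_add.
  have := measurableT_comp (measurable_affine a 0) (@measurable_fst _ _ Qp Qp).
  by congr measurable_fun; apply/funext => w /=; rewrite addr0.
have := measurableT_comp (measurable_affine b 0) (@measurable_snd _ _ Qp Qp).
by congr measurable_fun; apply/funext => w /=; rewrite addr0.
Qed.

Lemma measurable_form_preimage (a b : Qp) A :
  measurable A -> measurable [set w : Qp * Qp | A (a * w.1 + b * w.2)].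
Proof. by move=> mA; rewrite -[X in measurable X]setTI; exact: measurable_form. Qed.

(** For fixed x in p^k1 Z_p, invariance of [m2] replaces y by y - x and turns the forms into y and
    (1 - alpha) x + alpha y. For fixed y, invariance of [m1] then removes alpha y, so the joint law
    is a product. *)
Lemma forms_joint_law A B : measurable A -> measurable B ->
  P [set w | A (w.1 + w.2) /\ B (w.1 + alpha * w.2)] =
  (m2 A * m1 [set x | B ((1 - alpha) * x)%R])%E.
Proof.
move=> mA mB.
pose S := [set w : Qp * Qp | A (1 * w.1 + 1 * w.2)] `&`
          [set w : Qp * Qp | B (1 * w.1 + alpha * w.2)].
pose S' := [set w : Qp * Qp | A (0 * w.1 + 1 * w.2)] `&`
           [set w : Qp * Qp | B ((1 - alpha) * w.1 + alpha * w.2)].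
have mS : measurable S by apply: measurableI; exact: measurable_form_preimage.
have mS' : measurable S' by apply: measurableI; exact: measurable_form_preimage.
have -> : [set w : Qp * Qp | A (w.1 + w.2) /\ B (w.1 + alpha * w.2)] = S.
  by apply/funext => w; rewrite /S /setI /= !mul1r.
have PS : P S = P S'.
  rewrite /P /= /product_measure1.
  apply: ge0_ae_eq_integral => //.
  - exact: measurable_fun_xsection.
  - exact: measurable_fun_xsection.
  apply: filterS (supported_ae s1) => x kx _ /=.
  rewrite -(i2 (zballN kx) (measurable_xsection x mS)).
  congr (m2 _); apply/seteqP; split=> y; rewrite /xsection /= !in_setE => -[/= h1 h2].
    split=> /=; [move: h1|move: h2]; [congr A|congr B]; ring.
  split=> /=; [move: h1|move: h2]; [congr A|congr B]; ring.
(* Fubini: the second substitution is made in x, with y fixed. *)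
rewrite PS; transitivity ((m1 \x^ m2)%E S').
  by apply: product_measure_unique => // A1 A2 mA1 mA2; exact: product_measure2E.
rewrite /= /product_measure2.
set E := [set x | B _].
have mE : measurable E.
  have := measurable_affine_preimage (1 - alpha) 0 mB.
  by congr measurable; apply/funext => x /=; rewrite addr0.
transitivity (\int[m2]_y ((\1_A y)%:E * m1 E))%E; last first.
  by rewrite ge0_integralZr//; [rewrite integral_indic// setIT|
    apply/measurable_EFinP; exact: measurable_indic].
apply: ge0_ae_eq_integral => //.
- exact: measurable_fun_ysection.
- apply: emeasurable_funM => //.
  by apply/measurable_EFinP; exact: measurable_indic.
- by move=> y _; rewrite mule_ge0.
apply: filterS (supported_ae s2) => y ky _ /=.
rewrite indicE; have [Ay|nAy] := boolP (y \in A).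
  rewrite mul1e -(i1 (aj ky) mE); congr (m1 _).
  move/set_mem : Ay => Ay.
  have xE x : (1 - alpha) * ((1 - alpha)^-1 * (alpha * y) + x)
      = (1 - alpha) * x + alpha * y by rewrite mulrDr mulVKf// addrC.
  apply/seteqP; split=> x.
    by move=> /ysectionP[_ /=]; rewrite /E /= xE.
  rewrite /E /= xE => h; apply/ysectionP; split=> //=.
  by rewrite mul0r mul1r add0r.
rewrite mul0e (_ : ysection _ _ = set0) ?measure0//.
apply/seteqP; split=> // x /ysectionP[/= + _].
by rewrite mul0r mul1r add0r => Ay; move/negP: nAy; apply; exact/mem_set.
Qed.

(** Taking A or B to be the whole space in the joint law gives the marginals. *)
Lemma forms_independent :
  independent_rv P (fun w => w.1 + w.2) (fun w => w.1 + alpha * w.2).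
Proof.
have L1 : (fun w : Qp * Qp => w.1 + w.2) = (fun w => 1 * w.1 + 1 * w.2).
  by apply/funext => w; rewrite !mul1r.
have L2 : (fun w : Qp * Qp => w.1 + alpha * w.2) = (fun w => 1 * w.1 + alpha * w.2).
  by apply/funext => w; rewrite !mul1r.
split; [by rewrite L1; exact: measurable_form|by rewrite L2; exact: measurable_form|].
move=> A B mA mB.
have PA : P ((fun w => w.1 + w.2) @^-1` A) = m2 A.
  have := forms_joint_law mA measurableT.
  rewrite (_ : mkset _ = (fun w : Qp * Qp => w.1 + w.2) @^-1` A); last first.
    by apply/seteqP; split=> w //= [].
  move=> ->; rewrite (_ : mkset _ = setT); last by apply/seteqP; split.
  by rewrite probability_setT mule1.
have PB : P ((fun w => w.1 + alpha * w.2) @^-1` B) = m1 [set x | B ((1 - alpha) * x)].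
  have := forms_joint_law measurableT mB.
  rewrite (_ : mkset _ = (fun w : Qp * Qp => w.1 + alpha * w.2) @^-1` B); last first.
    by apply/seteqP; split=> w //= [].
  by move=> ->; rewrite probability_setT mul1e.
by rewrite PA PB -forms_joint_law.
Qed.

Lemma fst_law A : measurable A -> P (fst @^-1` A) = m1 A.
Proof.
move=> mA; have -> : fst @^-1` A = A `*` (@setT Qp) by apply/seteqP; split=> // w [].
have -> : P (A `*` setT) = (m1 A * m2 setT)%E by exact: product_measure1E.
by rewrite probability_setT mule1.
Qed.

Lemma snd_law A : measurable A -> P (snd @^-1` A) = m2 A.
Proof.
move=> mA; have -> : snd @^-1` A = (@setT Qp) `*` A by apply/seteqP; split=> // w [].
have -> : P (setT `*` A) = (m1 setT * m2 A)%E by exact: product_measure1E.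
by rewrite probability_setT mul1e.
Qed.

Lemma coordinates_independent : independent_rv P fst snd.
Proof.
split; [exact: measurable_fst|exact: measurable_snd|].
by move=> A B mA mB; rewrite fst_law// snd_law//; exact: product_measure1E.
Qed.

End IndependentFormsExample.

(** * The counterexample *)

Section NonIdempotentExample.
Variables (R : realType) (p : nat) (pr_p : prime p).
Local Notation Qp := (padic pr_p).
Local Notation Zp := (padic_int pr_p).
Local Notation iota := (@padic_of_int p pr_p).
Implicit Types (m mu : probability Qp R) (k : int) (A : set Qp).

Lemma supported_full m k A : supported_on m k -> measurable A ->
  zball k `<=` A -> m A = 1%E.
Proof.
move=> mk mA kA; apply/le_anti; rewrite probability_le1//= -mk.
by apply: le_measure; rewrite ?inE//; exact: measurable_zball.
Qed.

Lemma supported_null m k A : supported_on m k -> measurable A ->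
  (forall x, zball k x -> ~ A x) -> m A = 0%E.
Proof.
move=> mk mA kA; have := @probability_setC _ _ _ m _ (measurableC mA).
rewrite setCK => ->; rewrite (supported_full mk _ kA) ?subee//.
exact: measurableC.
Qed.

Lemma non_idempotent mu x y k :
  mu (coset_ball x k) = (3^-1)%:E -> mu (coset_ball y k) = (2 / 3)%:E ->
  ~ idempotent_distribution mu.
Proof.
move=> mx my idem.
have : (3^-1 : R)%:E = (2 / 3)%:E.
  by rewrite -mx -my; apply: idempotent_coset_mass => //; rewrite ?mx ?my eqe;
    rewrite ?mulf_neq0 ?invr_eq0 ?pnatr_eq0.
by case; clear mx my => h; lra.
Qed.

Lemma zball1_one : ~ zball 1 (1 : Qp).
Proof.
rewrite -(rmorph1 iota) => /(zball_residue 1).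
by rewrite residue1 expn1 modn_small// prime_gt1.
Qed.

(** Uniform on p Z_p with weight 1/3 and on 1 + p Z_p with weight 2/3; these cosets are distinct for
    every p, including 2. *)
Definition biased_law : probability Qp R :=
  mixture_law (affine_law (haar R pr_p) 0) (affine_law (haar R pr_p) 1).

Let haar_supported : supported_on (haar R pr_p) 0.
Proof.
have := haar_coset R (0 : Zp) 0; rewrite expr0 invr1 rmorph0.
by rewrite /supported_on => <-; congr (haar R pr_p _); apply/funext => x;
  rewrite /coset_ball /= subr0.
Qed.

Let zball01 : zball 0 (1 : Qp).
Proof. by have := zball_int (1 : Zp); rewrite rmorph1. Qed.

Lemma biased_law_supported : supported_on biased_law 0.
Proof.
apply: mixture_supported; apply: (affine_law_supported _ _ haar_supported) => //.
exact: zball0.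
Qed.

Lemma biased_law_invariant : invariant_under biased_law 1.
Proof.
by apply: mixture_invariant; rewrite -[X in invariant_under _ X]add0r;
  apply: affine_law_invariant => x A; exact: haar_invariant.
Qed.

Let pzball (x : Qp) : zball 1 (p%:R * x) <-> zball 0 x.
Proof. by have := zball_expM 1 0 x; rewrite expr1z addr0. Qed.

Lemma biased_law_mass0 : biased_law (coset_ball 0 1) = (3^-1)%:E.
Proof.
have mB (b : Qp) : measurable [set x | coset_ball 0 1 (p%:R * x + b)].
  by apply: measurable_affine_preimage; exact: measurable_coset_ball.
rewrite /biased_law mixture_lawE !affine_lawE.
rewrite (supported_full haar_supported (mB 0)) ?(supported_null haar_supported (mB 1)).
- by rewrite mule1 mule0 adde0.
- move=> x /pzball px; rewrite /coset_ball /= subr0 => h; apply: zball1_one.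
  by have := zballB h px; rewrite addrAC subrr add0r.
- by move=> x /pzball px; rewrite /coset_ball /= addr0 subr0.
Qed.

Lemma biased_law_mass1 : biased_law (coset_ball 1 1) = (2 / 3)%:E.
Proof.
have mB (b : Qp) : measurable [set x | coset_ball 1 1 (p%:R * x + b)].
  by apply: measurable_affine_preimage; exact: measurable_coset_ball.
rewrite /biased_law mixture_lawE !affine_lawE.
rewrite (supported_null haar_supported (mB 0)) ?(supported_full haar_supported (mB 1)).
- by rewrite mule1 mule0 add0e.
- by move=> x /pzball px; rewrite /coset_ball /= addrK.
- move=> x /pzball px; rewrite /coset_ball /= addr0 => h; apply: zball1_one.
  by have := zballB px h; rewrite opprB addrC subrK.
Qed.

Lemma biased_law_non_idempotent : ~ idempotent_distribution biased_law.
Proof. exact: non_idempotent biased_law_mass0 biased_law_mass1. Qed.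

Lemma scaled_biased_law_non_idempotent :
  ~ idempotent_distribution (affine_law biased_law 0).
Proof.
have E (x : Qp) : affine_law biased_law 0 (coset_ball (p%:R * x) 2) =
    biased_law (coset_ball x 1).
  rewrite affine_lawE; congr (biased_law _); apply/funext => y.
  rewrite /coset_ball /= addr0 -mulrBr; apply/propext.
  by have := zball_expM 1 1 (y - x); rewrite expr1z.
apply: (@non_idempotent _ (p%:R * 0) (p%:R * 1) 2); rewrite E.
  exact: biased_law_mass0.
exact: biased_law_mass1.
Qed.

Definition coordinate1 (w : Qp * Qp) : Qp := w.1.
Definition coordinate2 (w : Qp * Qp) : Qp := w.2.

HB.instance Definition _ := isMeasurableFun.Build _ _ (Qp * Qp)%type Qp
  coordinate1 (@measurable_fst _ _ Qp Qp).
HB.instance Definition _ := isMeasurableFun.Build _ _ (Qp * Qp)%type Qp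
  coordinate2 (@measurable_snd _ _ Qp Qp).

Lemma idempotent_ext mu m : (forall A, measurable A -> mu A = m A) ->
  idempotent_distribution mu -> idempotent_distribution m.
Proof.
move=> E [K [h [x [cK hK muE]]]]; exists K, h, x; split=> // A mA.
by rewrite -E// muE.
Qed.

Lemma exists_non_idempotent (c : Zp) (n : nat) : (2 <= n)%N ->
  exists (d : measure_display) (T : measurableType d) (P : probability T R)
    (X Y : {RV P >-> Qp}),
  [/\ independent_rv P X Y,
      independent_rv P (fun w => X w + Y w)
        (fun w => X w + p%:R ^ n%:Z * iota c * Y w),
      ~ idempotent_distribution (distribution P X) &
      ~ idempotent_distribution (distribution P Y)].
Proof.
move=> n2; set alpha : Qp := p%:R ^ n%:Z * iota c.
pose a0 : Zp := p%:R ^+ n * c.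
have alE : alpha = iota a0.
  by rewrite /alpha /a0 rmorphM rmorphXn rmorph_nat.
have ua : 1 - a0 \is a GRing.unit.
  apply/padic_unitP/eqP; rewrite residue_subr residue_eq0M.
    by rewrite residue1 expn1 modn_small// prime_gt1.
  by rewrite -natrX residue_nat expn1; apply/eqP; rewrite -/(dvdn _ _) dvdn_exp// ltnW.
have alE1 : 1 - alpha = iota (1 - a0) by rewrite alE rmorphB rmorph1.
have inv : (1 - alpha)^-1 = iota (1 - a0)^-1.
  by rewrite alE1 rmorphV.
have al1 : 1 - alpha != 0.
  rewrite alE1 -(rmorph0 iota) (inj_eq (@padic_of_int_inj p pr_p)).
  by apply: contraTneq ua => ->; rewrite unitr0.
pose m2 := biased_law; pose m1 := affine_law m2 0.
have s2 : supported_on m2 0 := biased_law_supported.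
have s1 : supported_on m1 1.
  by apply: (affine_law_supported _ _ s2) => //; exact: zball0.
have i2 : invariant_under m2 1 := biased_law_invariant.
have i1 : invariant_under m1 2 by exact: affine_law_invariant i2.
(* This is where n >= 2 enters: [m1], the image of [m2] under multiplication by p, is invariant only
   under p^2 Z_p, which must contain alpha Z_p. Dividing by the unit 1 - alpha is harmless. *)
have aj (y : Qp) : zball 0 y -> zball 2 ((1 - alpha)^-1 * (alpha * y)).
  move=> y0; rewrite inv; apply: zball_intM.
  have : zball (n%:Z + 0) (alpha * y) by apply: zballM => //; exists c.
  by apply: zball_le; lia.
exists _, (Qp * Qp)%type, (m1 \x m2)%E, coordinate1, coordinate2.
have indep := coordinates_independent m1 m2.
split => //.
- exact: (forms_independent s1 s2 i2 i1 al1 aj).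
- move=> h; apply: scaled_biased_law_non_idempotent; apply: idempotent_ext h.
  by move=> A mA; exact: fst_law.
- move=> h; apply: biased_law_non_idempotent; apply: idempotent_ext h.
  by move=> A mA; exact: snd_law.
Qed.

End NonIdempotentExample.

Theorem theorem1 (R : realType) (p : nat) (pr_p : prime p)
    (alpha : padic pr_p) (k : int) (c : padic_int pr_p)
    (alpha_neq0 : alpha != 0) (c_unit : c \is a GRing.unit)
    (alphaE : alpha = p%:R ^ k * padic_of_int c) :
  ((k = 0 \/ `|k| = 1) ->
   forall (d : measure_display) (T : measurableType d) (P : probability T R)
     (xi1 xi2 : {RV P >-> padic pr_p}),
   independent_rv P xi1 xi2 ->
   independent_rv P (fun w => xi1 w + xi2 w) (fun w => xi1 w + alpha * xi2 w) ->
   (k = 0 ->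
      (idempotent_distribution (distribution P xi1) /\
       idempotent_distribution (distribution P xi2)) /\
      (padic_digit c 0 = 1%N ->
       degenerate_distribution (distribution P xi1) /\
       degenerate_distribution (distribution P xi2))) /\
   (`|k| = 1 ->
      idempotent_distribution (distribution P xi1) \/
      idempotent_distribution (distribution P xi2)))
  /\
  (2 <= `|k| ->
   exists (d : measure_display) (T : measurableType d) (P : probability T R)
     (xi1 xi2 : {RV P >-> padic pr_p}),
   [/\ independent_rv P xi1 xi2,
       independent_rv P (fun w => xi1 w + xi2 w)
         (fun w => xi1 w + alpha * xi2 w),
       ~ idempotent_distribution (distribution P xi1) &
       ~ idempotent_distribution (distribution P xi2)]).
Proof.
have alphaVE : alpha^-1 = p%:R ^ (- k) * padic_of_int c^-1.
  by rewrite alphaE invfM invr_expz rmorphV.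
have cV_unit : c^-1 \is a GRing.unit by rewrite unitrV.
split.
  move=> _ d T P xi1 xi2 ind12 indL; split=> [k0|k1].
    apply: (independent_forms_unit _ _ ind12 c_unit) => //.
    by move: indL; rewrite alphaE k0 expr0z mul1r.
  have [k1' | k1'] : k = 1 \/ k = -1 by lia.
    apply: (independent_forms_prime _ _ ind12 c_unit) => //.
    by move: indL; rewrite alphaE k1' expr1z rmorphM rmorph_nat.
  (* For k = -1 the variables are exchanged, the coefficient becoming p c^-1. *)
  apply/or_comm.
  apply: (independent_forms_prime _ _ (independent_rvC ind12) cV_unit) => //.
  have := independent_forms_inv alpha_neq0 indL.
  by rewrite alphaVE k1' opprK expr1z rmorphM rmorph_nat.
move=> k2; have [kE | kE] : k = `|k|%N%:Z \/ - k = `|k|%N%:Z by lia.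
  by rewrite alphaE kE; apply: exists_non_idempotent; lia.
(* For negative k the example is built for alpha^-1, and its variables are exchanged. *)
have [|d [T [P [X [Y [indXY indL nX nY]]]]]] :=
  @exists_non_idempotent R p pr_p c^-1 `|k|%N; first by lia.
exists d, T, P, Y, X; split=> //; first exact: independent_rvC.
rewrite -kE -alphaVE in indL.
have alV0 : alpha^-1 != 0 by rewrite invr_eq0.
by have := independent_forms_inv alV0 indL; rewrite invrK.
Qed.
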